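(* Let $\Omega=(a,b)\subset\mathbb{R}$ be a finite open interval, $0<\alpha<1$ and $1<p<\infty$. Then there exists a constant $C=C(\alpha,\Omega)>0$ such that $$\|u\|_{L^p(\Omega)}\le C\|{}^{\pm}\mathcal{D}^{\alpha}u\|_{L^p(\Omega)}\qquad\forall u\in W^{\alpha,p}(\Omega)$$ (for each of the signs $-$ and $+$).
   Context: For $0<\alpha<1$ and $\varphi\in C_0^\infty(\mathbb{R})$: ${}^{-}D^{\alpha}\varphi(x)=\frac{1}{\Gamma(1-\alpha)}\frac{d}{dx}\int_{-\infty}^x\frac{\varphi(y)}{(x-y)^{\alpha}}dy$ and ${}^{+}D^{\alpha}\varphi(x)=\frac{-1}{\Gamma(1-\alpha)}\frac{d}{dx}\int_x^{\infty}\frac{\varphi(y)}{(y-x)^{\alpha}}dy$. For $u\in L^1(\Omega)$, $v\in L^1_{loc}(\Omega)$ is the left (resp. right) weak fractional derivative of $u$, $v={}^{-}\mathcal{D}^{\alpha}u$ (resp. ${}^{+}\mathcal{D}^{\alpha}u$), if $\int_\Omega v\varphi\,dx=\int_\Omega u\,{}^{+}D^{\alpha}\tilde\varphi\,dx$ (resp. with ${}^{-}D^{\alpha}\tilde\varphi$) for all $\varphi\in C_0^\infty(\Omega)$, where $\tilde\varphi$ is the zero extension of $\varphi$ to $\mathbb{R}$. ${}^{\pm}W^{\alpha,p}(\Omega)=\{u\in L^p(\Omega): {}^{\pm}\mathcal{D}^{\alpha}u\in L^p(\Omega)\}$, and the symmetric space is $W^{\alpha,p}(\Omega)={}^{-}W^{\alpha,p}(\Omega)\cap{}^{+}W^{\alpha,p}(\Omega)$.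 *)

(* Defs.v *)
From HB Require Import structures.
From mathcomp Require Import all_boot all_order all_algebra.
From mathcomp Require Import all_classical all_reals all_analysis.

Set Implicit Arguments.
Unset Strict Implicit.
Unset Printing Implicit Defensive.

Import Order.TTheory GRing.Theory Num.Theory.
Import numFieldNormedType.Exports.

Local Open Scope classical_set_scope.
Local Open Scope ring_scope.

(* A function on an open set [Omega] of the real line is represented by a
   function [R -> R] whose values outside [Omega] are irrelevant: every notion
   below only looks at it on [Omega], or at its extension by zero
   [f \_ Omega] (the default value [point] of [R] is [0]). Likewise, elements of
   Lebesgue spaces are represented by functions rather than by classes modulo
   almost everywhere equality. *)

Section fractional_derivatives.
Context {R : realType}.
Local Notation mu := (@lebesgue_measure R).
Implicit Types (Omega : set R) (alpha p s x : R) (u v phi : R -> R).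

Definition Gamma s : R :=
  \int[mu]_(t in `]0, +oo[) (t `^ (s - 1) * expR (- t)).

Definition test_function Omega phi :=
  [/\ forall n x, Omega x -> derivable (derive1n n phi) x 1,
      compact (closure [set x | Omega x /\ phi x != 0]) &
      closure [set x | Omega x /\ phi x != 0] `<=` Omega].

Definition left_frac_deriv alpha phi x : R :=
  (Gamma (1 - alpha))^-1 *
  derive1 (fun z => \int[mu]_(y in `]-oo, z[) (phi y / (z - y) `^ alpha)) x.

Definition right_frac_deriv alpha phi x : R :=
  - (Gamma (1 - alpha))^-1 *
  derive1 (fun z => \int[mu]_(y in `]z, +oo[) (phi y / (y - z) `^ alpha)) x.

Definition Lp_norm Omega p u : \bar R :=
  'N[mu]_(p%:E)[EFin \o (u \_ Omega)]%E.

Definition Lp_space Omega p : set (R -> R) :=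
  [set u | u \_ Omega \in Lfun mu p%:E].

Definition left_weak_deriv Omega alpha u v :=
  [/\ Lp_space Omega 1 u, locally_integrable Omega v &
    forall phi, test_function Omega phi ->
      \int[mu]_(x in Omega) (v x * phi x) =
      \int[mu]_(x in Omega) (u x * right_frac_deriv alpha (phi \_ Omega) x)].

Definition right_weak_deriv Omega alpha u v :=
  [/\ Lp_space Omega 1 u, locally_integrable Omega v &
    forall phi, test_function Omega phi ->
      \int[mu]_(x in Omega) (v x * phi x) =
      \int[mu]_(x in Omega) (u x * left_frac_deriv alpha (phi \_ Omega) x)].

Definition left_frac_Sobolev Omega alpha p : set (R -> R) :=
  [set u | Lp_space Omega p u /\
    exists2 v, left_weak_deriv Omega alpha u v & Lp_space Omega p v].

Definition right_frac_Sobolev Omega alpha p : set (R -> R) :=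
  [set u | Lp_space Omega p u /\
    exists2 v, right_weak_deriv Omega alpha u v & Lp_space Omega p v].

Definition frac_Sobolev Omega alpha p : set (R -> R) :=
  left_frac_Sobolev Omega alpha p `&` right_frac_Sobolev Omega alpha p.

End fractional_derivatives.

(* Main.v *)
From HB Require Import structures.
Require Import Defs.
From mathcomp Require Import all_boot all_order all_algebra.
From mathcomp Require Import all_classical all_reals all_analysis.
From mathcomp Require Import measurable_realfun ring lra.
Import Order.TTheory GRing.Theory Num.Theory.
Import numFieldNormedType.Exports.
Local Open Scope classical_set_scope.
Local Open Scope ring_scope.
Set Implicit Arguments.
Unset Strict Implicit.
Unset Printing Implicit Defensive.

(* Let [c = Gamma (1 - alpha)]. Testing the weak identity on primitives of mean
   zero functions shows that the convolution of [u] with [t^(-alpha)] is [c] times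
   the primitive of [v], up to a constant [K]. Convolving once more with
   [t^(alpha-1)] (Abel's method, with [B] the Beta integral) gives
     [B u(x) = K (x - a)^(alpha-1) + c \int_a^x v(t) (x - t)^(alpha-1) dt],
   and the other one-sided derivative yields a similar formula with the singular
   term at [b]. Integrated over [[a, a + e]], the latter is [o(e^alpha)], whereas
   the former is [K e^alpha / alpha + o(e^alpha)]; hence [K = 0]. The estimate is
   then Young's convolution inequality for the integrable kernel [t^(alpha-1)] on
   [(0, b - a)]. The right derivative is reduced to the left one by reflection. *)

(** * Translations and reflections of integrals *)

Section change_of_variables.
Context {R : realType}.
Local Notation mu := (@lebesgue_measure R).
Implicit Types (f : R -> R) (r c : R).

(** A single one-sided derivative cannot control [u]: the function (x - a)^(alpha-1) has left weak
    derivative zero, and it lies in L^p when (1 - alpha) p < 1. The constant K measures this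
    obstruction. It is invisible to test functions, which vanish at both ends and so have
    derivatives of mean zero. The right derivative excludes it because the singular function on that
    side, (b - x)^(alpha-1), is regular near [a].

    The formulas for [u] are kept in integrated form: Abel's second convolution produces the
    integral of [u] from [a] to z, an identity valid at every z, and Lebesgue differentiation
    returns to [u] only at the end.

    Since B is the Beta value Gamma(alpha) Gamma(1 - alpha), the factor c / B is 1 / Gamma(alpha),
    and the final constant is (b - a)^alpha / Gamma(alpha + 1). It is the same for all p and both
    signs because Young's inequality bounds convolution on every L^p by the mass of the kernel. *)

Lemma measurable_affine r c : measurable_fun [set: R] (fun x : R => r * x + c).
Proof. by apply: measurable_funD => //; exact: measurable_funM. Qed.

Let phi r c : measurableTypeR R -> measurableTypeR R := fun x => r * x + c.

Let mphi r c : measurable_fun setT (phi r c).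
Proof. exact: measurable_affine. Qed.

Let lebesgue_measure_affine r c (A : set R) : 0 < r -> measurable A ->
  (r%:E * pushforward mu (phi r c)%R A)%E = mu A.
Proof.
move=> r0 mA.
pose m := mscale (NngNum (ltW r0)) (pushforward mu (phi r c)) :
   {measure set (measurableTypeR R) -> \bar R}.
rewrite -[LHS]/(m (@mphi r c) A); apply/esym.
apply: lebesgue_measure_unique => // _ [[x y]] _ <-.
rewrite -[RHS]/(r%:E * mu (phi r c @^-1` `]x, y]))%E.
have -> : phi r c @^-1` [set` `]x, y]] = [set` `](x - c) / r, (y - c) / r]].
  apply/seteqP; split => t; rewrite /phi /= !in_itv /= ltr_pdivrMr// ler_pdivlMr//
   ltrBlDr lerBrDr mulrC //.
rewrite !lebesgue_measure_itv/= !lte_fin ltr_pM2r ?invr_gt0// ltrD2r.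
case: ifPn => _; last by rewrite mule0.
by rewrite -EFinD -EFinM; congr (_%:E); field; rewrite gt_eqF.
Qed.

Lemma ge0_integral_affine r c (f : R -> \bar R) : 0 < r ->
  measurable_fun [set: R] f -> (forall x, 0 <= f x)%E ->
  (r%:E * \int[mu]_x f (r * x + c)%R = \int[mu]_x f x)%E.
Proof.
move=> r0 mf f0.
pose m := pushforward mu (phi r c) : {measure set (measurableTypeR R) -> \bar R}.
transitivity (r%:E * \int[m (@mphi r c)]_x f x)%E.
  by congr (_ * _)%E; rewrite (ge0_integral_pushforward (@mphi r c)).
rewrite -(ge0_integral_mscale _ _ (NngNum (ltW r0))) //.
apply: eq_measure_integral => A mA _ /=.
exact: lebesgue_measure_affine.
Qed.

Lemma integralDr c (f : R -> \bar R) : measurable_fun [set: R] f ->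
  (\int[mu]_x f (x + c)%R = \int[mu]_x f x)%E.
Proof.
have ge0 g : measurable_fun [set: R] g -> (forall x, 0 <= g x)%E ->
    (\int[mu]_x g (x + c)%R = \int[mu]_x g x)%E.
  move=> mg g0; rewrite -(@ge0_integral_affine 1 c g)// mul1e.
  by under [RHS]eq_integral do rewrite mul1r.
move=> mf; rewrite [RHS]integralE [LHS]integralE.
congr (_ - _)%E.
- rewrite -(ge0 (f^\+)%E) //; last exact: measurable_funepos.
  by apply: eq_integral => x _; rewrite !unlock.
- rewrite -(ge0 (f^\-)%E) //; last exact: measurable_funeneg.
  by apply: eq_integral => x _; rewrite !unlock.
Qed.

Lemma integral_oppr (f : R -> \bar R) : measurable_fun [set: R] f ->
  (\int[mu]_x f (- x)%R = \int[mu]_x f x)%E.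
Proof.
pose o : measurableTypeR R -> measurableTypeR R := -%R.
have mo : measurable_fun setT o by exact: oppr_measurable.
pose m := pushforward mu o : {measure set (measurableTypeR R) -> \bar R}.
have ge0 g : measurable_fun [set: R] g -> (forall x, 0 <= g x)%E ->
    (\int[mu]_x g (- x)%R = \int[mu]_x g x)%E.
  move=> mg g0; transitivity (\int[m mo]_x g x)%E.
    by rewrite (ge0_integral_pushforward mo).
  by apply: eq_measure_integral => A mA _; exact: lebesgue_measureN.
move=> mf; rewrite [RHS]integralE [LHS]integralE.
congr (_ - _)%E.
- rewrite -(ge0 (f^\+)%E) //; last exact: measurable_funepos.
  by apply: eq_integral => x _; rewrite !unlock.
- rewrite -(ge0 (f^\-)%E) //; last exact: measurable_funeneg.
  by apply: eq_integral => x _; rewrite !unlock.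
Qed.

Lemma measurable_reflect c : measurable_fun [set: R] (fun x : R => c - x).
Proof. exact: measurable_funB. Qed.

Lemma integral_reflect c (f : R -> \bar R) : measurable_fun [set: R] f ->
  (\int[mu]_x f (c - x)%R = \int[mu]_x f x)%E.
Proof.
move=> mf; rewrite -[RHS](@integralDr c)// -[RHS]integral_oppr.
  by apply: eq_integral => x _; rewrite addrC.
by apply: measurableT_comp => //; exact: measurable_funD.
Qed.

Lemma Rintegral_reflect c f : measurable_fun [set: R] f ->
  \int[mu]_x f (c - x) = \int[mu]_x f x.
Proof.
move=> mf; congr fine; apply: (@integral_reflect c (EFin \o f)).
exact/measurable_EFinP.
Qed.

Lemma RintegralDr c f : measurable_fun [set: R] f ->
  \int[mu]_x f (x + c) = \int[mu]_x f x.
Proof.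
move=> mf; congr fine; apply: (@integralDr c (EFin \o f)).
exact/measurable_EFinP.
Qed.

Lemma integrable_reflect c f : mu.-integrable setT (EFin \o f) ->
  mu.-integrable setT (EFin \o (fun x => f (c - x))).
Proof.
move=> /integrableP[mf foo]; apply/integrableP; split.
  by apply: measurableT_comp mf _; exact: measurable_reflect.
by rewrite (@integral_reflect c (abse \o (EFin \o f)))//; exact: measurableT_comp.
Qed.

End change_of_variables.

(** * Integrable kernels *)

Section fubini_real.
Context {R : realType}.
Local Notation mu := (@lebesgue_measure R).
Implicit Types (u v : R -> R) (K : R -> R -> R).

Lemma ae_imply (P Q : R -> Prop) : (forall x, P x -> Q x) ->
  {ae mu, forall x, P x} -> {ae mu, forall x, Q x}.
Proof. by move=> PQ; apply: filterS => //; exact: (ae_filter_ringOfSetsType mu). Qed.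

Lemma ae_imply2 (P Q S : R -> Prop) : (forall x, P x -> Q x -> S x) ->
  {ae mu, forall x, P x} -> {ae mu, forall x, Q x} -> {ae mu, forall x, S x}.
Proof. by move=> PQ; apply: filterS2 => //; exact: (ae_filter_ringOfSetsType mu). Qed.

Lemma le_integrable_norm u g : measurable_fun [set: R] u ->
  (forall x, `|u x| <= g x) -> mu.-integrable setT (EFin \o g) ->
  mu.-integrable setT (EFin \o u).
Proof.
move=> mu' ug ig; apply: le_integrable ig => //; first exact/measurable_EFinP.
by move=> x _ /=; rewrite lee_fin (le_trans (ug x))// ler_norm.
Qed.

Lemma integrable_normP u : measurable_fun [set: R] u ->
  (\int[mu]_x `|u x|%:E < +oo)%E -> mu.-integrable setT (EFin \o u).
Proof. by move=> m_u h; apply/integrableP; split; [exact/measurable_EFinP|]. Qed.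

Lemma EFin_Rintegral u : mu.-integrable setT (EFin \o u) ->
  (\int[mu]_x u x)%:E = (\int[mu]_x (u x)%:E)%E.
Proof. by move=> iu; rewrite fineK//; exact: integrable_fin_num. Qed.

Lemma RintegralZl_setT (c : R) u : mu.-integrable setT (EFin \o u) ->
  \int[mu]_x (c * u x) = c * \int[mu]_x u x.
Proof. by move=> iu; exact: RintegralZl. Qed.

Lemma integrable_lin (c d : R) u v :
  mu.-integrable setT (EFin \o u) -> mu.-integrable setT (EFin \o v) ->
  mu.-integrable setT (EFin \o (fun x => c * u x + d * v x)).
Proof.
move=> iu iv; have := integrableD measurableT (integrableZl measurableT c iu)
  (integrableZl measurableT d iv).
exact: eq_integrable.
Qed.

Lemma Rintegral_lin (c d : R) u v :
  mu.-integrable setT (EFin \o u) -> mu.-integrable setT (EFin \o v) ->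
  \int[mu]_x (c * u x + d * v x) = c * \int[mu]_x u x + d * \int[mu]_x v x.
Proof.
move=> iu iv; rewrite -!RintegralZl_setT// -RintegralD//.
- exact: (integrableZl measurableT c iu).
- exact: (integrableZl measurableT d iv).
Qed.

Lemma Rintegral_ae_eq (f : R -> \bar R) g : mu.-integrable setT f ->
  measurable_fun setT g ->
  {ae mu, forall x, f x = (g x)%:E} ->
  mu.-integrable setT (EFin \o g) /\ (\int[mu]_x (g x)%:E = \int[mu]_x f x)%E.
Proof.
move=> /integrableP[mf foo] mg fg.
have e : ae_eq mu setT f (EFin \o g) 
  by apply: (@filterS _ _ (ae_filter_ringOfSetsType mu) _ _ _ fg) => x /= ? _.
have mg' : measurable_fun setT (EFin \o g) by exact/measurable_EFinP.
split; last by apply: ae_eq_integral => //; exact: ae_eq_sym.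
apply/integrableP; split => //.
rewrite (@ae_eq_integral _ _ _ mu setT (abse \o f) (abse \o (EFin \o g)))//.
- exact: measurableT_comp.
- exact: measurableT_comp.
- by apply: (@filterS _ _ (ae_filter_ringOfSetsType mu) _ _ _ e) => x /= h /h /= ->.
Qed.

Lemma measurable_pair1 (f : R * R -> R) x : measurable_fun setT f ->
  measurable_fun setT (fun y => f (x, y)).
Proof. by move=> mf; exact: measurableT_comp. Qed.

(** The uniform bound on the mass of [K x] makes [u x * K x y] integrable on the plane by Tonelli.
    Real-valued integrals are [fine] of extended ones, so an inner integral over x may be a default
    value on a null set of y; the third conclusion isolates the y where it is genuine. *)
Lemma Fubini_kernel u K (M : R) :
  mu.-integrable setT (EFin \o u) ->
  measurable_fun setT (fun z : R * R => K z.1 z.2) ->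
  (forall x, \int[mu]_y `|K x y|%:E <= M%:E)%E ->
  [/\ mu.-integrable setT (EFin \o (fun x => u x * \int[mu]_y K x y)),
      mu.-integrable setT (EFin \o (fun y => \int[mu]_x (u x * K x y))),
      {ae mu, forall y, mu.-integrable setT (EFin \o (fun x => u x * K x y))} &
      \int[mu]_x (u x * \int[mu]_y K x y) =
      \int[mu]_y \int[mu]_x (u x * K x y)].
Proof.
move=> iu mK KM.
have mu' : measurable_fun setT u by case/integrableP: iu => /measurable_EFinP.
pose f (z : R * R) := (u z.1 * K z.1 z.2)%:E.
have mf : measurable_fun setT f.
  by apply/measurable_EFinP/measurable_funM => //; exact: measurableT_comp.
have iK x : mu.-integrable setT (EFin \o (K x)).
  apply: integrable_normP.
    exact: (measurable_pair1 x mK).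
  exact: le_lt_trans (KM x) (ltry _).
have M0 : 0 <= M.
  by rewrite -lee_fin (le_trans _ (KM 0))//; apply: integral_ge0 => y _; rewrite lee_fin.
have fin : (mu \x mu)%E.-integrable setT f.
  apply/integrable12ltyP => //.
  apply: (@le_lt_trans _ _ (\int[mu]_x (M%:E * `|u x|%:E))%E).
    apply: ge0_le_integral => //.
    - by move=> x _; apply: integral_ge0.
    - apply: (measurable_fun_fubini_tonelli_F (m2 := mu) (abse \o f)).
      exact: measurableT_comp.
      by move=> z; exact: abse_ge0.
    - by apply/measurable_EFinP; apply: measurable_funM => //; exact: measurableT_comp.
    move=> x _.
    under eq_integral do rewrite /f /= normrM EFinM.
    rewrite ge0_integralZl//.
    - by rewrite muleC lee_pmul//; apply: integral_ge0 => y _; rewrite lee_fin.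
    - by apply/measurable_EFinP; apply: measurableT_comp => //; exact: (measurable_pair1 x mK).
  rewrite ge0_integralZl//; last by apply/measurable_EFinP; exact: measurableT_comp.
  by rewrite lte_mul_pinfty// ?lee_fin //; case/integrableP: iu.
have iuK x : mu.-integrable setT (EFin \o (fun y => u x * K x y)).
  exact: integrableZl (iK x).
have H1 x : (u x * \int[mu]_y K x y)%:E = (\int[mu]_y f (x, y))%E.
  by rewrite -RintegralZl// EFin_Rintegral.
have i1 := integrable_fubini_F fin.
have i2 : mu.-integrable setT (fubini_G mu f).
  apply/integrableP; split; first exact: (measurable_fubini_G fin).
  have h := (integrable21ltyP mu mu mf).1 fin; refine (le_lt_trans _ h).
  apply: ge0_le_integral => //.
  - by apply: measurableT_comp => //; exact: (measurable_fubini_G fin).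
  - apply: (measurable_fun_fubini_tonelli_G (m1 := mu) (abse \o f)).
      exact: measurableT_comp.
      by move=> z; exact: abse_ge0.
  - by move=> y _; apply: le_abse_integral => //; exact: measurableT_comp.
have m2 : measurable_fun setT (fun y => \int[mu]_x (u x * K x y)).
  apply: (@measurableT_comp _ _ _ _ _ _ fine) => //.
  by case/integrableP: i2.
have ae2 := ae_integrable2 fin.
have [j2 e2] : mu.-integrable setT (EFin \o (fun y => \int[mu]_x (u x * K x y))) /\
   (\int[mu]_y (\int[mu]_x (u x * K x y))%:E = \int[mu]_y fubini_G mu f y)%E.
  apply: Rintegral_ae_eq => //.
  apply: ae_imply ae2 => y iy.
  by rewrite EFin_Rintegral.
split => //.
- by apply: eq_integrable i1 => // x _ /=; rewrite H1.
- by congr fine; under eq_integral do rewrite H1; rewrite (Fubini fin) e2.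
Qed.
End fubini_real.

(** * Smooth functions *)

Section flat_functions.
Context {R : realType}.
Implicit Types (f g : R -> R) (x : R) (p q : {poly R}).

(** The power [k] is there for stability under differentiation: the derivative at order k combines
    orders k + 1 and k + 2. *)
Definition flat_exp (k : nat) x : R := if 0 < x then x ^- k * expR (- x^-1) else 0.

Lemma flat_exp_ge0 k x : 0 <= flat_exp k x.
Proof.
rewrite /flat_exp; case: ifPn => // x0.
by rewrite mulr_ge0 ?expR_ge0// invr_ge0 exprn_ge0 // ltW.
Qed.

(** This is e^t >= t^(k+1) / (k+1)! at t = 1 / x. It serves at the origin, where it forces
    difference quotients to tend to 0. *)
Lemma flat_exp_le k x : flat_exp k x <= k.+1`!%:R * `|x|.
Proof.
rewrite /flat_exp; case: ifPn => x0; last by rewrite mulr_ge0.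
have xV0 : 0 < x^-1 by rewrite invr_gt0.
have f0 : 0 < k.+1`!%:R :> R by rewrite ltr0n fact_gt0.
have xk0 : 0 < x ^+ k.+1 by rewrite exprn_gt0.
have le : expR (- x^-1) <= k.+1`!%:R * x ^+ k.+1.
  rewrite expRN -[leRHS]invrK lef_pV2 ?posrE ?expR_gt0 ?invr_gt0 ?mulr_gt0//.
  apply: le_trans (expR_ge1Dxn k (ltW xV0)).
  by rewrite invfM -exprVn mulrC lerDr.
rewrite (gtr0_norm x0) (@le_trans _ _ (x ^- k * (k.+1`!%:R * x ^+ k.+1)))//.
  by rewrite ler_wpM2l// invr_ge0 exprn_ge0// ltW.
by rewrite exprSr mulrCA mulKf// expf_neq0// gt_eqF.
Qed.

Lemma is_derive_flat_exp k x :
  is_derive x 1 (flat_exp k) (- k%:R * flat_exp k.+1 x + flat_exp k.+2 x).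
Proof.
have [x0|x0|->] := ltgtP x 0.
- apply: (@near_eq_is_derive _ _ _ (cst 0)) => //; last first.
    rewrite /flat_exp !ifF ?mulr0 ?addr0; last 2 first.
    by apply/negbTE; rewrite -leNgt ltW.
    by apply/negbTE; rewrite -leNgt ltW.
    exact: is_derive_cst.
  near=> y; rewrite /flat_exp ifF//; apply/negbTE; rewrite -leNgt ltW//.
  by near: y; exact: lt_nbhsl.
- apply: (@near_eq_is_derive R R^o R^o (fun y => (y ^+ k)^-1 * expR (- y^-1))).
    near=> y; rewrite /flat_exp ifT//; near: y; exact: lt_nbhsr.
  rewrite /flat_exp x0.
  have xn0 : x != 0 by rewrite gt_eqF.
  have dV : is_derive x 1 (fun y : R => y^-1) (- x ^- 2).
    by apply: is_derive_eq; [exact: (@is_deriveV _ id)|rewrite /= scaler1].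
  have dN : is_derive x 1 (fun y : R => - y^-1) (x ^- 2).
    by rewrite -[x ^- 2]opprK; exact: is_deriveN.
  have dE : is_derive x 1 (fun y : R => expR (- y^-1)) (expR (- x^-1) * x ^- 2).
    exact: (@is_derive1_comp _ expR).
  have dXk : is_derive x 1 (fun y : R => y ^+ k) (k%:R * x ^+ k.-1).
    have := is_derive_poly 'X^k x.
    rewrite derivXn hornerMn hornerXn mulr_natl.
    by congr (is_derive _ _ _ _); apply/funext => y; rewrite hornerXn.
  have dX : is_derive x 1 (fun y : R => (y ^+ k)^-1) (- k%:R * x ^- k.+1).
    apply: is_derive_eq; first apply: (@is_deriveV _ (fun y => y ^+ k)).
    + by rewrite expf_neq0.
    rewrite /= /GRing.scale/=.
    clear -xn0; case: k => [|k]; first by rewrite mul0r mulr0 oppr0 mul0r.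
    rewrite /= !exprS; field.
    by rewrite xn0 expf_neq0.
  have H : is_derive x 1 ((fun y : R => y ^- k) * (fun y : R => expR (- y^-1)))
    (- k%:R * (x ^- k.+1 * expR (- x^-1)) + x ^- k.+2 * expR (- x^-1)).
    apply: is_derive_eq; rewrite /GRing.scale /= !exprS; field.
    by rewrite xn0 expf_neq0.
  exact: H.
- rewrite {2 3}/flat_exp ltxx mulr0 addr0.
  (* The difference quotient of [flat_exp k] at 0 is [flat_exp k.+1] itself, so only the continuity
     of the latter at 0 remains. *)
  apply/is_derive1_caratheodory; exists (flat_exp k.+1); split.
  + move=> z; rewrite /flat_exp ltxx !subr0; case: ifPn => z0; last by rewrite mul0r.
    by rewrite exprS; field; rewrite expf_neq0 gt_eqF.
  + have e0 : flat_exp k.+1 0 = 0 by rewrite /flat_exp ltxx.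
    change (flat_exp k.+1 @ (0:R) --> flat_exp k.+1 0); rewrite e0.
    apply: norm_cvg0.
    apply: (@squeeze_cvgr _ _ _ _ (cst 0) (fun z => k.+2`!%:R * `|z|)).
    * apply: nearW => z; rewrite normr_ge0/= ger0_norm ?flat_exp_ge0//.
      exact: flat_exp_le.
    * exact: cvg_cst.
    * have h : `|z| @[z --> (0:R)] --> (0:R).
        have : `|z| @[z --> (0:R)] --> `|0:R| by apply: cvg_norm; exact: cvg_id.
        by rewrite normr0.
      have := cvgM (cvg_cst (k.+2`!%:R : R)) h; rewrite mulr0; exact.
  + by rewrite /flat_exp ltxx.
Unshelve. all: by end_near. Qed.

(* A class containing the bumps below and closed under differentiation. *)
Inductive flat : (R -> R) -> Prop :=
| flat_base k q p : flat (fun x => flat_exp k q.[x] * p.[x])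
| flat_add f g : flat f -> flat g -> flat (fun x => f x + g x).

Lemma flat_derive f : flat f ->
  exists g, flat g /\ forall x, is_derive x 1 f (g x).
Proof.
elim=> [k q p|{}f g _ [f' [ff' df]] _ [g' [fg' dg]]]; last first.
  exists (fun x => f' x + g' x); split; first exact: flat_add.
  by move=> x; exact: is_deriveD.
pose h x := flat_exp k q.[x] * (p^`()).[x] +
  (flat_exp k.+1 q.[x] * (- k%:R *: (p * q^`())).[x] +
   flat_exp k.+2 q.[x] * (p * q^`()).[x]).
exists h; split; first by repeat (apply: flat_add || apply: flat_base).
move=> x; apply: is_derive_eq.
  apply: is_deriveM; first apply: (@is_derive1_comp _ (flat_exp k) (horner q)).
  exact: is_derive_flat_exp.
rewrite /GRing.scale /h /= hornerZ !hornerM; ring.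
Qed.

(** Carrying the whole sequence of derivatives as a witness makes passing to a primitive a mere
    shift of the sequence. *)
Definition smooth f := exists d : nat -> R -> R,
  d 0%N = f /\ forall n x, is_derive x 1 (d n) (d n.+1 x).

Lemma flat_smooth f : flat f -> smooth f.
Proof.
move=> ff.
have /choice[F FP] : forall g, exists g', flat g -> flat g' /\ forall x, is_derive x 1 g (g' x).
  move=> g; have [/flat_derive[g' [g'1 g'2]]|ng] := pselect (flat g).
    by exists g'.
  by exists g.
exists (fun n => iter n F f); split => // n x /=.
have fn : flat (iter n F f) by elim: n => //= n /FP[].
by have [_] := FP _ fn.
Qed.

Lemma smooth_derivable f n x : smooth f -> derivable (derive1n n f) x 1.
Proof.
move=> [d [<- dd]].
have -> : derive1n n (d 0%N) = d n.
  elim: n => // n IH; rewrite derive1nS IH; apply/funext => y.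
  by rewrite derive1E; exact: derive_val.
exact: ex_derive.
Qed.

Lemma smooth_continuous f : smooth f -> continuous f.
Proof.
move=> [d [<- dd]] x; apply/differentiable_continuous/derivable1_diffP.
exact: ex_derive.
Qed.

Lemma smooth_primitive f F : smooth f -> (forall x, is_derive x 1 F (f x)) -> smooth F.
Proof.
move=> [d [<- dd]] dF; exists (fun n => if n is m.+1 then d m else F); split => //.
by case.
Qed.

Lemma smooth_reflect c f : smooth f -> smooth (fun x => f (c - x)).
Proof.
move=> [d [<- dd]]; exists (fun n x => (-1) ^+ n * d n (c - x)); split.
  by apply/funext => x; rewrite mul1r.
move=> n x.
have h : is_derive x 1 (fun x => d n (c - x)) (d n.+1 (c - x) * -1).
  apply: (@is_derive1_comp _ (d n) (fun x => c - x)).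
  have -> : -1 = 0 - 1 :> R by rewrite sub0r.
  exact: is_deriveB.
have H : is_derive x 1 ((cst ((-1) ^+ n) : R -> R) * (fun x => d n (c - x)))
    ((-1) ^+ n.+1 * d n.+1 (c - x)).
  by apply: is_derive_eq; rewrite /GRing.scale /= exprS; ring.
exact: H.
Qed.
End flat_functions.

(** * Test densities *)

Section bumps.
Context {R : realType}.
Local Notation mu := (@lebesgue_measure R).
Local Notation L1 f := (mu.-integrable setT (EFin \o f)).
Implicit Types (a b z x : R) (f g psi : R -> R).

Lemma dominated_cvg_Rintegral (F : nat -> R -> R) f g :
  (forall n, measurable_fun setT (F n)) -> L1 g ->
  (forall n x, `|F n x| <= g x) -> (forall x, F n x @[n --> \oo] --> f x) ->
  \int[mu]_x F n x @[n --> \oo] --> \int[mu]_x f x.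
Proof.
move=> mF ig Fg Ff.
have mf : measurable_fun setT f by exact: (measurable_fun_cvg mF (fun x _ => Ff x)).
have [||||i_f _] := @dominated_convergence _ _ _ mu setT measurableT
    (fun n x => (F n x)%:E) (EFin \o f) (EFin \o g) _ _ _ ig.
- by move=> n; apply: measurableT_comp => //; exact: mF.
- by apply: measurableT_comp => //; exact: mf.
- by apply: aeW => x _; apply: cvg_EFin; [exact: nearW|exact: Ff].
- by apply: aeW => x n _; rewrite lee_fin.
- rewrite /= -[X in _ --> X]EFin_Rintegral//; exact: fine_cvg.
Qed.

Lemma bounded_support_integrable f s t M : measurable_fun setT f ->
  (forall x, f x != 0 -> s <= x <= t) -> (forall x, `|f x| <= M) -> L1 f.
Proof.
move=> mf fst fM.
have M0 : 0 <= M by exact: le_trans (fM 0).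
apply: (@le_integrable_norm _ _ (fun x => M * \1_(`[s, t]) x)) => //.
  move=> x; rewrite indicE; have [fx|fx] := eqVneq (f x) 0.
    by rewrite fx normr0 mulr_ge0.
  by rewrite mem_set ?mulr1//= in_itv/=; exact: fst.
exact: (integrableZl measurableT M (integrable_indic_itv s t true false)).
Qed.

(** Subtracting 1 pushes the support strictly inside (a, z), to the points where (x - a)(z - x) > 1
    / (n+1); the factor n + 1 makes the bumps tend to the indicator of the open interval. *)
Definition bump a z (n : nat) x := flat_exp 0 (n.+1%:R * ((x - a) * (z - x)) - 1).

Lemma bump_ge0 a z n x : 0 <= bump a z n x.
Proof. exact: flat_exp_ge0. Qed.

Lemma bump_le1 a z n x : bump a z n x <= 1.
Proof.
rewrite /bump /flat_exp; case: ifPn => // h.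
by rewrite expr0 invr1 mul1r -[leRHS]expR0 ler_expR oppr_le0 invr_ge0 ltW.
Qed.

Lemma bump_support a z n x : a < z -> bump a z n x != 0 ->
  a + (n.+1%:R * (z - a))^-1 <= x <= z - (n.+1%:R * (z - a))^-1.
Proof.
move=> az; rewrite /bump /flat_exp; case: ifPn => [h _|]; last by rewrite eqxx.
have d0 : 0 < z - a by rewrite subr_gt0.
have n0 : 0 < n.+1%:R :> R by rewrite ltr0n.
have nd0 : 0 < n.+1%:R * (z - a) by rewrite mulr_gt0.
have h1 : 1 < n.+1%:R * ((x - a) * (z - x)) by rewrite -subr_gt0.
have p0 : 0 < (x - a) * (z - x).
  by rewrite -(pmulr_rgt0 _ n0); exact: lt_trans h1.
(* Two numbers with positive product and positive sum [z - a] are both positive. *)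
have [xa xz] : 0 < x - a /\ 0 < z - x.
  split; nra.
have h2 : n.+1%:R * ((x - a) * (z - x)) <= n.+1%:R * ((x - a) * (z - a)).
  by rewrite ler_wpM2l// ler_wpM2l ?ltW//; lra.
have h3 : n.+1%:R * ((x - a) * (z - x)) <= n.+1%:R * ((z - a) * (z - x)).
  by rewrite ler_wpM2l// ler_wpM2r ?ltW//; lra.
apply/andP; split.
- rewrite -lerBrDl -[leLHS]mul1r ler_pdivrMr// mulrCA.
  by rewrite (le_trans (ltW h1)).
- rewrite lerBrDr -lerBrDl -[leLHS]mul1r ler_pdivrMr// mulrCA (mulrC (z - x)).
  by rewrite (le_trans (ltW h1)).
Qed.

Lemma bump_support_lt a z n x : a < z -> bump a z n x != 0 -> a < x < z.
Proof.
move=> az /(bump_support az)/andP[h1 h2].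
have d0 : 0 < (n.+1%:R * (z - a))^-1 by rewrite invr_gt0 mulr_gt0// subr_gt0.
by rewrite (lt_le_trans _ h1) ?ltrDl// (le_lt_trans h2)// gtrBl.
Qed.

Lemma bump_cvg a z x : a < z ->
  bump a z n x @[n --> \oo] --> (\1_(`]a, z[) x : R).
Proof.
move=> az; rewrite indicE; have [xaz|xaz] := boolP (x \in `]a, z[).
  rewrite mem_set//=; move: xaz; rewrite in_itv/= => /andP[ax xz].
  pose C := (x - a) * (z - x).
  have C0 : 0 < C by rewrite mulr_gt0// subr_gt0.
  (* For s = (n+1) C - 1, the inequality e^(-1/s) >= 1 - 1/s applies, and s >= (n+1) C / 2 as soon
     as (n+1) C >= 2. *)
  apply: (@squeeze_cvgr _ _ _ _ (fun n => 1 - (2 / C) * harmonic n) (cst 1)).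
  - near=> n; rewrite bump_le1 andbT /bump -/C.
    have h : 2 <= n.+1%:R * C.
      rewrite -ler_pdivrMr//; apply: (@le_trans _ _ n%:R); last by rewrite ler_nat.
      by near: n; exact: nbhs_infty_ger.
    have h2 : n.+1%:R * C / 2 <= n.+1%:R * C - 1 by lra.
    have h3 : 0 < n.+1%:R * C / 2 by lra.
    rewrite /flat_exp ifT; last by lra.
    rewrite expr0 invr1 mul1r; apply: le_trans (expR_ge1Dx _).
    rewrite lerD2l lerN2.
    have -> : 2 / C * harmonic n = (n.+1%:R * C / 2)^-1.
      by rewrite /harmonic/= !invfM invrK; ring.
    by rewrite lef_pV2// posrE//; lra.
  - rewrite -[X in _ --> X]subr0 -[X in _ --> _ - X](mulr0 (2 / C)).
    apply: cvgB; first exact: cvg_cst.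
    by apply: cvgM; [exact: cvg_cst|exact: cvg_harmonic].
  - exact: cvg_cst.
rewrite memNset//; last by apply/negP.
rewrite (_ : (fun n => _) = cst 0); first exact: cvg_cst.
apply/funext => n; apply/eqP/negPn/negP => /(bump_support_lt az) h.
by move: xaz; rewrite in_itv/= h.
Unshelve. all: by end_near. Qed.

(* The derivatives of the test functions on [(a, b)]. *)
Definition test_density a b psi := [/\ smooth psi,
  exists s t, [/\ a < s, t < b & forall x, psi x != 0 -> s <= x <= t] &
  \int[mu]_x psi x = 0].

Lemma flat_bump c a z n : flat (fun x => c * bump a z n x).
Proof.
have -> : (fun x => c * bump a z n x) = fun x =>
   flat_exp 0 (n.+1%:R *: (('X - a%:P) * (z%:P - 'X)) - 1).[x] * c%:P.[x].
  by apply/funext => x; rewrite /bump !hornerE mulrC.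
exact: flat_base.
Qed.

Lemma smooth_bump a z n : smooth (bump a z n).
Proof.
have := flat_smooth (flat_bump 1 a z n).
by under eq_fun do rewrite mul1r.
Qed.

Lemma smooth_measurable f : smooth f -> measurable_fun setT f.
Proof. by move=> /smooth_continuous; exact: continuous_measurable_fun. Qed.

Lemma bump_integrable a z n : a < z -> L1 (bump a z n).
Proof.
move=> az; apply: (@bounded_support_integrable _ _ _ 1).
- by apply: smooth_measurable; exact: smooth_bump.
- by move=> x; exact: bump_support.
- by move=> x; rewrite ger0_norm ?bump_ge0// bump_le1.
Qed.

Lemma test_density_bounded a b psi : test_density a b psi ->
  exists M, forall x, `|psi x| <= M.
Proof.
move=> [/smooth_continuous cpsi [s [t [_ _ pst]]] _].
have [st|ts] := leP s t; last first.
  exists 0 => x; rewrite normr_le0; apply/negPn/negP => /pst /andP[sx xt].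
  by move: (le_trans sx xt); rewrite leNgt ts.
have [|c _ cmax] := @EVT_max _ (fun x => `|psi x|) _ _ st.
  apply: continuous_subspaceT => x; apply: continuous_comp; first exact: cpsi.
  exact: norm_continuous.
exists `|psi c| => x; have [->|/pst xst] := eqVneq (psi x) 0; first by rewrite normr0.
by apply: cmax; rewrite in_itv.
Qed.

Lemma test_density_integrable a b psi : test_density a b psi -> L1 psi.
Proof.
move=> dpsi; have [M psiM] := test_density_bounded dpsi.
case: dpsi => spsi [s [t [_ _ pst]]] _.
exact: (bounded_support_integrable (smooth_measurable spsi) pst psiM).
Qed.

Lemma test_density_reflect a b psi : test_density a b psi ->
  test_density a b (fun x => psi (a + b - x)).
Proof.
move=> [spsi [s [t [sa tb pst]]] ipsi]; split.
- exact: smooth_reflect.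
- exists (a + b - t), (a + b - s); split; [lra|lra|].
  by move=> x /pst /andP[? ?]; apply/andP; split; lra.
- by rewrite Rintegral_reflect//; exact: smooth_measurable.
Qed.

(** Each bump is weighted by the mass of the other, so the total mass cancels without any
    division. *)
Lemma test_density_bumps a b z w n k : a < z -> z < b -> a < w -> w < b ->
  test_density a b (fun x =>
    (\int[mu]_y bump a w k y) * bump a z n x +
    - (\int[mu]_y bump a z n y) * bump a w k x).
Proof.
move=> az zb aw wb.
have iz := bump_integrable n az; have iw := bump_integrable k aw.
split.
- by apply: flat_smooth; apply: flat_add; exact: flat_bump.
(* Both bumps start at [a], so the left end needs the gap provided by [bump_support]; on the right,
   [z] and [w] already lie below [b]. *)
- exists (a + Num.min (n.+1%:R * (z - a))^-1 (k.+1%:R * (w - a))^-1), (Num.max z w).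
  have z0 : 0 < (n.+1%:R * (z - a))^-1 by rewrite invr_gt0 mulr_gt0// subr_gt0.
  have w0 : 0 < (k.+1%:R * (w - a))^-1 by rewrite invr_gt0 mulr_gt0// subr_gt0.
  split.
  + by rewrite ltrDl lt_min z0 w0.
  + by rewrite gt_max zb wb.
  + move=> x; rewrite -lerBrDl ge_min le_max.
    have [->|/(bump_support az)/andP[h1 h2] _] := eqVneq (bump a z n x) 0.
      have [->|/(bump_support aw)/andP[h1 h2] _] := eqVneq (bump a w k x) 0.
        by rewrite !mulr0 addr0 eqxx.
      apply/andP; split; apply/orP; right; first by rewrite lerBrDl.
      by rewrite (le_trans h2)// gerBl ltW.
    apply/andP; split; apply/orP; left; first by rewrite lerBrDl.
    by rewrite (le_trans h2)// gerBl ltW.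
- by rewrite (Rintegral_lin _ _ iz iw); ring.
Qed.

(* du Bois-Reymond *)
Lemma orthogonal_densities_const a b (G : R -> R) : a < b -> L1 G ->
  (forall psi, test_density a b psi -> \int[mu]_x (G x * psi x) = 0) ->
  exists c, forall z, a < z < b ->
    \int[mu]_x (G x * \1_(`]a, z[) x) = c * (z - a).
Proof.
move=> ab iG orth.
have mG : measurable_fun setT G by case/integrableP: iG => /measurable_EFinP.
have mb z n : measurable_fun setT (bump a z n) by apply: smooth_measurable; exact: smooth_bump.
have iGb z n : L1 (fun x => G x * bump a z n x).
  apply: (@le_integrable_norm _ _ (fun x => `|G x|)).
  - exact: measurable_funM.
  - by move=> x; rewrite normrM ler_piMr// ger0_norm ?bump_ge0// bump_le1.
  - exact: integrable_norm.
have lim1 z : a < z -> \int[mu]_x bump a z n x @[n --> \oo] --> z - a.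
  move=> az.
  have -> : z - a = \int[mu]_x \1_(`]a, z[) x.
    rewrite /Rintegral integral_indic//= setIT lebesgue_measure_itv/= lte_fin az.
    by rewrite -EFinD.
  apply: (@dominated_cvg_Rintegral _ _ (\1_(`[a, z]))) => //.
  - exact: integrable_indic_itv.
  - move=> n x; rewrite ger0_norm ?bump_ge0// indicE.
    have [->|/(bump_support_lt az)/andP[h1 h2]] := eqVneq (bump a z n x) 0; first by [].
    by rewrite mem_set//= ?bump_le1// in_itv/= !ltW.
  - by move=> x; exact: bump_cvg.
have lim2 z : a < z -> \int[mu]_x (G x * bump a z n x) @[n --> \oo] -->
    \int[mu]_x (G x * \1_(`]a, z[) x).
  move=> az; apply: (@dominated_cvg_Rintegral _ _ (fun x => `|G x|)).
  - by move=> n; exact: measurable_funM.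
  - exact: integrable_norm.
  - by move=> n x; rewrite normrM ler_piMr// ger0_norm ?bump_ge0// bump_le1.
  - by move=> x; apply: cvgM; [exact: cvg_cst|exact: bump_cvg].
pose w := (a + b) / 2.
have aw : a < w by rewrite /w; lra.
have wb : w < b by rewrite /w; lra.
have [k mk0] : exists k, 0 < \int[mu]_x bump a w k x.
  have : \forall n \near \oo, 0 < \int[mu]_x bump a w n x.
    by apply: (cvgr_gt (w - a)); [exact: lim1|rewrite subr_gt0].
  by case=> N _ /(_ N (leqnn _)); exists N.
(* The constant is the mean of [G] weighted by one fixed bump of positive mass. Every other bump is
   compared with it through [test_density_bumps], and n then tends to infinity to replace
   [bump a z n] by an indicator. *)
exists ((\int[mu]_x (G x * bump a w k x)) / \int[mu]_x bump a w k x).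
move=> z /andP[az zb].
have eqn n : (\int[mu]_x bump a w k x) * (\int[mu]_x (G x * bump a z n x)) =
   (\int[mu]_x bump a z n x) * (\int[mu]_x (G x * bump a w k x)).
  have := orth _ (test_density_bumps n k az zb aw wb).
  under eq_Rintegral do rewrite mulrDr mulrCA (mulrCA (G _)).
  by rewrite (Rintegral_lin _ _ (iGb z n) (iGb w k)) mulNr => /eqP; rewrite subr_eq0 => /eqP.
have h1 : (\int[mu]_x bump a w k x) * (\int[mu]_x (G x * bump a z n x)) @[n --> \oo]
    --> (\int[mu]_x bump a w k x) * (\int[mu]_x (G x * \1_(`]a, z[) x)).
  by apply: cvgM; [exact: cvg_cst|exact: lim2].
have h2 : (\int[mu]_x bump a z n x) * (\int[mu]_x (G x * bump a w k x)) @[n --> \oo]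
    --> (z - a) * (\int[mu]_x (G x * bump a w k x)).
  by apply: cvgM; [exact: lim1|exact: cvg_cst].
rewrite (funext eqn) in h1.
have alg (m X c d : R) : 0 < m -> m * X = d * c -> X = c / m * d.
  by move=> m0 mX; rewrite mulrAC -mulrA mulrC -[LHS]mul1r -(mulVf (lt0r_neq0 m0)) -mulrA mX; ring.
exact: alg mk0 (cvg_unique _ h1 h2).
Qed.
End bumps.

(** * Fractional kernels *)

Section kernels.
Context {R : realType}.
Local Notation mu := (@lebesgue_measure R).
Local Notation L1 f := (mu.-integrable setT (EFin \o f)).
Implicit Types (s L t x y z : R).

Definition heaviside t : R := \1_(`]0, +oo[) t.

(** The truncation at [L] makes the kernel integrable on the whole line. With L = b - a it is
    invisible on differences of points of (a, b). *)
Definition frac_kernel s L t : R := t `^ (s - 1) * \1_(`]0, L[) t.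

(** The primitive of t^(s-1) on the positive half-line, continued by 0 to the left. *)
Definition frac_power s t : R := heaviside t * t `^ s / s.

Lemma heavisideE t : heaviside t = (0 < t)%O%:R.
Proof. by rewrite /heaviside indicE mem_setE in_itv/= andbT. Qed.

Lemma frac_kernelE s L t : frac_kernel s L t = if 0 < t < L then t `^ (s - 1) else 0.
Proof.
rewrite /frac_kernel indicE mem_setE in_itv/=.
by case: ifPn => _; rewrite ?mulr1 ?mulr0.
Qed.

Lemma heaviside_ge0 t : 0 <= heaviside t. Proof. by rewrite heavisideE. Qed.

Lemma frac_kernel_ge0 s L t : 0 <= frac_kernel s L t.
Proof. by rewrite frac_kernelE; case: ifPn => // _; exact: powR_ge0. Qed.

Lemma frac_power_ge0 s t : 0 < s -> 0 <= frac_power s t.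
Proof.
by move=> s0; rewrite /frac_power !mulr_ge0 ?heaviside_ge0 ?powR_ge0 ?invr_ge0 ?ltW.
Qed.

Lemma heaviside_le1 t : heaviside t <= 1.
Proof. by rewrite heavisideE lern1 leq_b1. Qed.

Lemma frac_kernel_le s L L' t : L <= L' -> frac_kernel s L t <= frac_kernel s L' t.
Proof.
move=> LL; rewrite !frac_kernelE; case: ifPn => [/andP[-> tL]|_].
  by rewrite (lt_le_trans tL LL).
by case: ifP => // _; exact: powR_ge0.
Qed.

Lemma measurable_heaviside : measurable_fun setT heaviside.
Proof. exact: measurable_indic. Qed.

Lemma measurable_frac_kernel s L : measurable_fun setT (frac_kernel s L).
Proof.
apply: measurable_funM; last exact: measurable_indic.
exact: measurable_powR.
Qed.

Lemma measurable_frac_power s : measurable_fun setT (frac_power s).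
Proof.
apply: measurable_funM => //; apply: measurable_funM.
  exact: measurable_heaviside.
exact: measurable_powR.
Qed.

Let integral_powR_cc s e L : 0 < s -> 0 < e -> e < L ->
  (\int[mu]_(t in `[e, L]) (t `^ (s - 1))%:E = (L `^ s / s - e `^ s / s)%:E)%E.
Proof.
move=> s0 e0 eL.
have dF t : 0 < t -> is_derive t 1 (fun t => t `^ s / s) (t `^ (s - 1)).
  move=> t0.
  have := is_deriveM (is_derive1_powR s t0) (is_derive_cst (s^-1 : R^o) (t : R^o) 1).
  rewrite /GRing.scale/= mulr0 add0r mulrA mulVf ?gt_eqF// mul1r; exact.
have cF t : 0 < t -> {for t, continuous (fun t => t `^ s / s)}.
  move=> t0; apply/differentiable_continuous/derivable1_diffP.
  by apply: ex_derive; exact: dF.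
rewrite (@continuous_FTC2 _ _ (fun t => t `^ s / s)) ?EFinB//.
- apply: derivable_within_continuous => t; rewrite in_itv/= => /andP[et _].
  apply: derivable_powR. by rewrite in_itv/= andbT (lt_le_trans e0).
- split.
  + move=> t; rewrite in_itv/= => /andP[et _]; apply: ex_derive; apply: dF.
    exact: lt_trans et.
  + apply: cvg_at_right_filter; apply: cF; exact: e0.
  + apply: cvg_at_left_filter; apply: cF; exact: lt_trans eL.
- move=> t; rewrite in_itv/= => /andP[et _]; rewrite derive1E.
  by apply: derive_val; apply: dF; exact: lt_trans et.
Qed.

(** The integrand may blow up at 0, so the fundamental theorem of calculus is applied on [e, L], and
    e tends to 0 by monotone convergence on the left and by continuity of the power on the right. *)
Lemma integral_frac_kernel s L : 0 < s ->
  (\int[mu]_t (frac_kernel s L t)%:E = (frac_power s L)%:E)%E.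
Proof.
move=> s0; have [L0|L0] := leP L 0.
  rewrite /frac_power heavisideE ltNge L0/= !mul0r.
  apply: integral0_eq => t _; rewrite frac_kernelE ifF//.
  by apply/negbTE/negP => /andP[t0 tL]; lra.
rewrite /frac_power heavisideE L0 mul1r.
transitivity (\int[mu]_(t in `]0%R, L[) (t `^ (s - 1))%:E)%E.
  rewrite [RHS]integral_mkcond; apply: eq_integral => t _.
  by rewrite restrict_EFin /= patch_indic.
rewrite integral_itv_bndo_bndc; last first.
  apply/measurable_EFinP; apply: measurable_funTS; exact: measurable_powR.
pose e n : R := L / 2 * harmonic n.
have h0 : 0 < L / 2 by rewrite divr_gt0.
have e0 n : 0 < e n by rewrite mulr_gt0 ?harmonic_gt0.
have eL n : e n < L.
  apply: (@le_lt_trans _ _ (L / 2)); last by lra.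
  by rewrite /e ler_piMr ?(ltW h0)// /harmonic/= invf_le1// ler1n.
have eC : e n @[n --> \oo] --> (0:R).
  by rewrite -(mulr0 (L / 2)); apply: cvgM; [exact: cvg_cst|exact: cvg_harmonic].
have h1 : (L `^ s / s - e n `^ s / s)%:E @[n --> \oo] --> (L `^ s / s)%:E.
  apply: cvg_EFin; first exact: nearW.
  rewrite -[X in _ --> X]subr0; apply: cvgB; first exact: cvg_cst.
  rewrite -(mul0r s^-1); apply: cvgM; last exact: cvg_cst.
  by move/cvg_at_rightP : (powR_cvg0 s0); apply; split.
have h2 : (\int[mu]_(t in `[e n, L]) (t `^ (s - 1))%:E)%E @[n --> \oo] -->
   (\int[mu]_(t in `]0%R, L]) (t `^ (s - 1))%:E)%E.
  have -> : `]0%R, L]%classic = \bigcup_n `[e n, L]%classic.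
    apply/seteqP; split => [t /=|t [n _]/=]; rewrite !in_itv/=.
      move=> /andP[t0 tL]; near \oo => n; exists n => //=; rewrite in_itv/= tL andbT ltW//.
      by near: n; apply: (cvgr_lt 0).
    by move=> /andP[et ->]; rewrite (lt_le_trans (e0 n)).
  apply: ge0_nondecreasing_set_cvg_integral.
  - move=> m n mn; rewrite subsetEset; apply: subset_itvr.
    by rewrite bnd_simp /e ler_pM2l// /harmonic/= lef_pV2 ?posrE// ler_nat.
  - by move=> n; exact: measurable_itv.
  - by move=> n; apply/measurable_EFinP; apply: measurable_funTS; exact: measurable_powR.
  - by move=> n x _; rewrite lee_fin powR_ge0.
have eqn n : (\int[mu]_(t in `[e n, L]) (t `^ (s - 1))%:E = (L `^ s / s - e n `^ s / s)%:E)%E.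
  exact: integral_powR_cc.
rewrite (funext eqn) in h2; exact: (cvg_unique _ h2 h1).
Unshelve. all: by end_near. Qed.

Lemma frac_kernel_integrable s L : 0 < s -> L1 (frac_kernel s L).
Proof.
move=> s0; apply: integrable_normP; first exact: measurable_frac_kernel.
under eq_integral do rewrite ger0_norm ?frac_kernel_ge0//.
by rewrite integral_frac_kernel// ltry.
Qed.

Lemma heaviside_frac_kernel s L d t : d <= L ->
  heaviside (d - t) * frac_kernel s L t = frac_kernel s d t.
Proof.
move=> dL; rewrite heavisideE subr_gt0 !frac_kernelE.
have [td|dt] := ltP t d; last by rewrite mul0r andbF.
by rewrite mul1r (lt_le_trans td dL).
Qed.

Lemma integral_heaviside_frac_kernel s L x z : 0 < s -> z - x <= L ->
  (\int[mu]_y (heaviside (z - y) * frac_kernel s L (y - x))%:E =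
   (frac_power s (z - x))%:E)%E.
Proof.
move=> s0 zxL; rewrite -integral_frac_kernel// -[RHS](integralDr (- x)); last first.
  by apply: measurableT_comp => //; exact: measurable_frac_kernel.
apply: eq_integral => y _; rewrite -(@heaviside_frac_kernel s L (z - x))//.
by congr (heaviside _ * _)%:E; ring.
Qed.

Lemma integral_frac_kernel_heaviside s L x z : 0 < s -> z - x <= L ->
  (\int[mu]_y (heaviside (y - x) * frac_kernel s L (z - y))%:E =
   (frac_power s (z - x))%:E)%E.
Proof.
move=> s0 zxL; rewrite -integral_frac_kernel// -[RHS](integral_reflect z); last first.
  by apply: measurableT_comp => //; exact: measurable_frac_kernel.
apply: eq_integral => y _; rewrite -(@heaviside_frac_kernel s L (z - x))//.
by congr (heaviside _ * _)%:E; ring.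
Qed.

(** Substitute y = x + (z - x) t. The two exponents add up to -1, which cancels the Jacobian z - x,
    so the value is the same Beta integral for all x < z; the truncation does not interfere since z
    - x <= L. For z <= x the two supports are disjoint. *)
Lemma beta_integral_frac_kernel alpha : 0 < alpha < 1 ->
  exists2 B : R, 0 < B & forall L x z, z - x <= L ->
  (\int[mu]_y (frac_kernel (1 - alpha) L (y - x) * frac_kernel alpha L (z - y))%:E =
   (B * heaviside (z - x))%:E)%E.
Proof.
move=> /andP[alpha0 alpha1].
pose g t := frac_kernel (1 - alpha) 1 t * frac_kernel alpha 1 (1 - t).
have g0 t : 0 <= g t by rewrite mulr_ge0 ?frac_kernel_ge0.
have mg : measurable_fun setT g.
  apply: measurable_funM; first exact: measurable_frac_kernel.
  by apply: measurableT_comp (measurable_frac_kernel _ _) _; exact: measurable_reflect.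
have powle s t : 0 < s < 1 -> 2^-1 <= t -> t `^ (s - 1) <= 2.
  move=> /andP[s0 s1] th; have h0 : 0 < 2^-1 :> R by lra.
  rewrite -opprB powRN -[leRHS]invrK lef_pV2 ?posrE//; last first.
    by rewrite powR_gt0// (lt_le_trans h0).
  apply: (@le_trans _ _ (2^-1 `^ (1 - s))); first by apply: ger1_powR; lra.
  by rewrite ge0_ler_powR// ?nnegrE; lra.
have powge r t : r <= 0 -> 0 < t < 1 -> 1 <= t `^ r.
  by move=> r0 /andP[t0 t1]; rewrite -(powRr0 t) ger_powR// t0 ltW.
(* On each half of (0, 1), the factor whose singularity sits at the opposite end is at most 2. *)
have gle t : g t <= 2 * frac_kernel (1 - alpha) 1 t + 2 * frac_kernel alpha 1 (1 - t).
  rewrite /g !frac_kernelE.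
  have -> : (0 < 1 - t < 1) = (0 < t < 1) by apply/idP/idP => /andP[? ?]; apply/andP; split; lra.
  case: ifPn => [/andP[t0 t1]|]; last by rewrite !mulr0 addr0.
  have p1 := powR_ge0 t (1 - alpha - 1).
  have p2 := powR_ge0 (1 - t) (alpha - 1).
  have [th|th] := leP 2^-1 t.
    rewrite (le_trans (ler_wpM2r p2 (powle _ _ _ th)))//; first by apply/andP; split; lra.
    by rewrite lerDr mulr_ge0.
  rewrite mulrC (le_trans (ler_wpM2r p1 (powle _ (1 - t) _ _)))//.
  - by apply/andP; split; lra.
  - by lra.
  - by rewrite lerDl mulr_ge0.
have ig : L1 g.
  apply: (le_integrable_norm mg
    (g := fun t => 2 * frac_kernel (1 - alpha) 1 t + 2 * frac_kernel alpha 1 (1 - t))).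
    by move=> x; rewrite ger0_norm.
  apply: integrable_lin; first by apply: frac_kernel_integrable; lra.
  by apply: integrable_reflect; apply: frac_kernel_integrable; lra.
exists (\int[mu]_t g t).
  (* Both factors are at least 1 on (0, 1), hence B >= 1. *)
  apply: (@lt_le_trans _ _ (\int[mu]_t \1_(`]0, 1[) t)).
    by rewrite /Rintegral integral_indic//= setIT lebesgue_measure_itv/= lte_fin ltr01 -EFinD subr0/=.
  apply: le_Rintegral => //; first exact: integrable_indic_itv.
  move=> t _; rewrite /g !frac_kernelE indicE mem_setE in_itv/=.
  have -> : (0 < 1 - t < 1) = (0 < t < 1) by apply/idP/idP => /andP[? ?]; apply/andP; split; lra.
  case: ifPn => [/andP[t0 t1]|]; last by rewrite mulr0.
  by rewrite -[leLHS]mulr1 ler_pM//; apply: powge; lra.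
move=> L x z zxL; rewrite heavisideE.
have [zx|zx] := ltP 0 (z - x); last first.
  rewrite mulr0; apply: integral0_eq => y _.
  rewrite !frac_kernelE; case: ifPn => [/andP[? _]|]; last by rewrite mul0r.
  by case: ifPn => [/andP[? _]|]; [exfalso; lra|rewrite mulr0].
rewrite mulr1 EFin_Rintegral//.
pose f y := (frac_kernel (1 - alpha) L (y - x) * frac_kernel alpha L (z - y))%:E.
have mf : measurable_fun [set: R] f.
  apply/measurable_EFinP; apply: measurable_funM.
    by apply: measurableT_comp (measurable_frac_kernel _ _) _; exact: measurable_funB.
  by apply: measurableT_comp (measurable_frac_kernel _ _) _; exact: measurable_reflect.
rewrite -/(f _) -(@ge0_integral_affine _ (z - x) x f)//; last first.
  by move=> y; rewrite lee_fin mulr_ge0// frac_kernel_ge0.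
rewrite -ge0_integralZl//.
- apply: eq_integral => t _; rewrite /f /g -EFinM; congr (_%:E).
  rewrite (_ : (z - x) * t + x - x = (z - x) * t); last ring.
  rewrite (_ : z - ((z - x) * t + x) = (z - x) * (1 - t)); last ring.
  set d := z - x in zx zxL *; rewrite !frac_kernelE !pmulr_rgt0//.
  have [t0|] := ltP 0 t; last by rewrite !mul0r mulr0.
  have [t1|] := ltP 0 (1 - t); last by rewrite !mulr0.
  have -> : d * t < L by rewrite (lt_le_trans _ zxL)// gtr_pMr//; lra.
  have -> : d * (1 - t) < L by rewrite (lt_le_trans _ zxL)// gtr_pMr//; lra.
  have -> : t < 1 by lra.
  have -> : 1 - t < 1 by lra.
  rewrite /=.
  rewrite !powRM ?ltW// mulrACA -powRD; last by rewrite (gt_eqF zx) implybT.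
  rewrite mulrA (_ : 1 - alpha - 1 + (alpha - 1) = - 1); last ring.
  by rewrite powR_inv1 ?ltW//; field; rewrite gt_eqF.
- exact: measurableT_comp mf (measurable_affine _ _).
- by move=> t _; rewrite lee_fin mulr_ge0// frac_kernel_ge0.
- by rewrite lee_fin ltW.
Qed.

(** A positive integrand does not suffice, as the real-valued integral of a function with infinite
    integral is 0. Integrability comes from the majorant t^(s-1) on (0, 1) plus the exponential
    density; positivity from the minorant e^(-1) on (0, 1). *)
Lemma Gamma_gt0 s : 0 < s < 1 -> 0 < Gamma s.
Proof.
move=> /andP[s0 s1].
pose f t := t `^ (s - 1) * expR (- t).
have mf : measurable_fun setT f.
  apply: measurable_funM; first exact: measurable_powR.
  by apply: measurableT_comp => //; exact: measurable_expR.
have f0 t : 0 <= f t by rewrite mulr_ge0 ?powR_ge0 ?expR_ge0.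
have ie : L1 (exponential_pdf (1 : R)).
  apply: integrable_normP; first exact: measurable_exponential_pdf.
  under eq_integral do rewrite ger0_norm ?exponential_pdf_ge0//.
  by rewrite integral_exponential_pdf// ltry.
have if_ : L1 (f \_ `]0, +oo[).
  apply: (@le_integrable_norm _ _ (fun t => 1 * frac_kernel s 1 t + 1 * exponential_pdf 1 t)).
  - by apply/(measurable_restrictT f) => //; exact: measurable_funTS.
  - move=> t; rewrite !mul1r patchE frac_kernelE mem_setE in_itv/= andbT.
    have [t0|t0] := ltP 0 t; last by rewrite normr0 add0r exponential_pdf_ge0.
    rewrite ger0_norm// (exponential_pdfE _ (ltW t0)) mul1r mulN1r /f.
    have [t1|t1] := ltP t 1.
      rewrite (@le_trans _ _ (t `^ (s - 1)))//; last by rewrite lerDl expR_ge0.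
      by rewrite ler_piMr ?powR_ge0// -[leRHS]expR0 ler_expR; lra.
    rewrite add0r ler_piMl ?expR_ge0// -[leRHS](powRr0 t) ler_powR//; lra.
  - by apply: integrable_lin; [exact: frac_kernel_integrable|].
rewrite /Gamma Rintegral_mkcond.
apply: (@lt_le_trans _ _ (\int[mu]_t (expR (- 1) * \1_(`]0, 1[) t))).
  rewrite RintegralZl_setT; last exact: integrable_indic_itv.
  rewrite mulr_gt0 ?expR_gt0// /Rintegral integral_indic//= setIT.
  by rewrite lebesgue_measure_itv/= lte_fin ltr01 -EFinD subr0/=.
apply: le_Rintegral => //.
  exact: (integrableZl measurableT (expR (- 1)) (integrable_indic_itv 0 1 false true)).
move=> t _; rewrite indicE mem_setE in_itv/= patchE mem_setE in_itv/= andbT.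
have [t0|t0] := ltP 0 t; last by rewrite mulr0.
have [t1|t1] := ltP t 1; rewrite ?mulr0 ?mulr1// ?f0//.
rewrite -[leLHS]mul1r ler_pM ?expR_ge0 ?ler_expR//; last by lra.
by rewrite -[leLHS](powRr0 t) ger_powR ?t0 ?(ltW t1)//; lra.
Qed.

End kernels.

(** * Abel's equation *)

Section kernel_operators.
Context {R : realType}.
Local Notation mu := (@lebesgue_measure R).
Local Notation L1 f := (mu.-integrable setT (EFin \o f)).
Implicit Types (u v w g : R -> R) (K : R -> R -> R).

Lemma ae_eq_Rintegral f g : measurable_fun setT f -> measurable_fun setT g ->
  {ae mu, forall x, f x = g x :> R} -> \int[mu]_x f x = \int[mu]_x g x.
Proof.
move=> mf mg fg; congr fine; apply: ae_eq_integral => //.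
- exact/measurable_EFinP.
- exact/measurable_EFinP.
- by apply: ae_imply fg => x /= -> _.
Qed.

Lemma L1_measurable g : L1 g -> measurable_fun setT g.
Proof. by case/integrableP => /measurable_EFinP. Qed.

(** Fubini is used for [K] as well as for the product with [w]: the integrability of [u x * K x y]
    in x for almost every y is what allows [w y] to be taken out of the inner integral. The mass of
    the product is bounded separately because [w] may be a singular kernel. *)
Lemma Fubini_kernel_mul u K w (M M' : R) : L1 u ->
  measurable_fun setT (fun z : R * R => K z.1 z.2) ->
  (forall x, \int[mu]_y `|K x y|%:E <= M%:E)%E ->
  measurable_fun setT w ->
  (forall x, \int[mu]_y `|K x y * w y|%:E <= M'%:E)%E ->
  L1 (fun y => (\int[mu]_x (u x * K x y)) * w y) /\
  \int[mu]_x (u x * \int[mu]_y (K x y * w y)) =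
  \int[mu]_y ((\int[mu]_x (u x * K x y)) * w y).
Proof.
move=> iu mK KM mw KwM.
have mKw : measurable_fun setT (fun z : R * R => K z.1 z.2 * w z.2).
  by apply: measurable_funM => //; exact: measurableT_comp.
have [_ i1 ae1 _] := Fubini_kernel iu mK KM.
have [_ i2 _ e2] := Fubini_kernel iu mKw KwM.
have m1 : measurable_fun setT (fun y => (\int[mu]_x (u x * K x y)) * w y).
  by apply: measurable_funM => //; exact: L1_measurable.
have m2 := L1_measurable i2.
have ae2 : {ae mu, forall y, \int[mu]_x (u x * (K x y * w y)) =
    (\int[mu]_x (u x * K x y)) * w y}.
  apply: ae_imply ae1 => y iy; rewrite -RintegralZr//.
  by apply: eq_Rintegral => x _; rewrite mulrA.
split; last by rewrite e2; exact: ae_eq_Rintegral.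
have [] // := @Rintegral_ae_eq R _ _ i2 m1.
by apply: ae_imply ae2 => y /= ->.
Qed.

Lemma kernel_mul_bound K (M C : R) w : (forall x, measurable_fun setT (K x)) ->
  (forall x, \int[mu]_y `|K x y|%:E <= M%:E)%E ->
  measurable_fun setT w -> (forall x, `|w x| <= C) ->
  forall x, (\int[mu]_y `|K x y * w y|%:E <= (C * M)%:E)%E.
Proof.
move=> mK KM mw wC x; have C0 : 0 <= C by exact: le_trans (wC 0).
apply: (@le_trans _ _ (\int[mu]_y (C%:E * `|K x y|%:E))%E).
  apply: ge0_le_integral => //.
  - by apply/measurable_EFinP; apply: measurableT_comp => //; apply: measurable_funM => //; exact: mK.
  - apply/measurable_EFinP; apply: measurable_funM => //.
    by apply: measurableT_comp => //; exact: mK.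
  - by move=> y _; rewrite -EFinM lee_fin normrM mulrC ler_wpM2r.
rewrite ge0_integralZl//; last first.
  by apply/measurable_EFinP; apply: measurableT_comp => //; exact: mK.
by rewrite EFinM lee_wpmul2l.
Qed.

(** By Lebesgue's differentiation theorem, [g] is almost everywhere the derivative of its primitive
    from [a], and that primitive is locally the zero function on (a, b). *)
Lemma ae_eq0_itv g (a b : R) : L1 g ->
  (forall z, a < z < b -> \int[mu]_x (g x * \1_(`]a, z[) x) = 0) ->
  {ae mu, forall x, a < x < b -> g x = 0}.
Proof.
move=> ig g0.
have locg : locally_integrable [set: R] g by apply: open_integrable_locally => //; exact: openT.
have igS (D : set R) : measurable D -> mu.-integrable D (EFin \o g).
  by move=> mD; apply: integrableS ig.
have := @FTC1 R g (BRight a) (fun y => igS _ (measurable_itv _)) locg.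
apply: ae_imply => x /= + /andP[ax xb] => /(_ ax)[_ <-].
have -> : 0 = (cst 0 : R -> R)^`()%classic x by rewrite derive1_cst.
rewrite !derive1E; apply: near_eq_derive.
have : x \in `]a, b[ by rewrite in_itv/= ax.
move=> /near_in_itvoo; apply: filterS => z; rewrite in_itv/= => zab.
rewrite -(@Rintegral_itv_bndo_bndc _ (BRight a) z g); last by apply: igS; exact: measurable_itv.
rewrite Rintegral_mkcond; apply: etrans (g0 _ zab).
by apply: eq_Rintegral => y _; rewrite patch_indic.
Qed.

End kernel_operators.

Section abel_equation.
Context {R : realType}.
Local Notation mu := (@lebesgue_measure R).
Local Notation L1 f := (mu.-integrable setT (EFin \o f)).
Variables (a b alpha : R).
Hypotheses (ab : a < b) (alpha01 : 0 < alpha < 1).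
Implicit Types (u v psi : R -> R) (x y z c : R).

Let Omega : set R := [set` `]a, b[].

Definition supported (u : R -> R) := forall x, ~~ (a < x < b) -> u x = 0.

(* The identity defining [v] as a left weak derivative of [u], on the test function
   [phi] with derivative [psi]: the inner integrals are [- phi x] and
   [- c * right_frac_deriv alpha phi x]. *)
Definition weak_identity c u v := forall psi, test_density a b psi ->
  c * \int[mu]_x (v x * \int[mu]_y (heaviside (y - x) * psi y)) =
  \int[mu]_x (u x * \int[mu]_y (frac_kernel (1 - alpha) (b - a) (y - x) * psi y)).

Let ka := frac_kernel (1 - alpha) (b - a).
Let kb := frac_kernel alpha (b - a).

Let alpha0 : 0 < alpha. Proof. by case/andP: alpha01. Qed.
Let alpha1 : 0 < 1 - alpha. Proof. by rewrite subr_gt0; case/andP: alpha01. Qed.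

Let measurable_sub : measurable_fun setT (fun p : R * R => p.2 - p.1).
Proof. by apply: measurable_funB; [exact: measurable_snd|exact: measurable_fst]. Qed.

(** The cut-off in y gives the Heaviside kernel a finite mass, at most b - a, and leaves integrals
    against densities supported in [Omega] unchanged. *)
Let Ka x y := ka (y - x) * \1_Omega y.
Let Kh x y := heaviside (y - x) * \1_Omega y.

Let m1 : measurable_fun setT (\1_Omega : R -> R).
Proof. by apply: measurable_indic; exact: measurable_itv. Qed.

Let mKa : measurable_fun setT (fun z : R * R => Ka z.1 z.2).
Proof.
apply: measurable_funM; last exact: measurableT_comp m1 measurable_snd.
exact: measurableT_comp (measurable_frac_kernel _ _) measurable_sub.
Qed.

Let mKh : measurable_fun setT (fun z : R * R => Kh z.1 z.2).
Proof.
apply: measurable_funM; last exact: measurableT_comp m1 measurable_snd.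
exact: measurableT_comp measurable_heaviside measurable_sub.
Qed.

Let Ka_ge0 x y : 0 <= Ka x y.
Proof. by rewrite mulr_ge0 ?frac_kernel_ge0. Qed.

Let Kh_ge0 x y : 0 <= Kh x y.
Proof. by rewrite mulr_ge0 ?heaviside_ge0. Qed.

Let Ka_le x y : Ka x y <= ka (y - x).
Proof. by rewrite ler_piMr ?frac_kernel_ge0. Qed.

Let Kh_le x y : Kh x y <= 1.
Proof. by rewrite mulr_ile1 ?heaviside_ge0// heaviside_le1. Qed.

Lemma ge0_le_integral_fun (f g : R -> R) : measurable_fun setT f ->
  measurable_fun setT g -> (forall x, 0 <= f x <= g x) ->
  (\int[mu]_x `|f x|%:E <= \int[mu]_x (g x)%:E)%E.
Proof.
move=> mf mg fg; apply: ge0_le_integral => //.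
- by apply/measurable_EFinP; exact: measurableT_comp.
- exact/measurable_EFinP.
- by move=> x _; rewrite lee_fin; case/andP: (fg x) => f0 ?; rewrite ger0_norm.
Qed.

Let int_ka x : (\int[mu]_y (ka (y - x))%:E = (frac_power (1 - alpha) (b - a))%:E)%E.
Proof.
rewrite -integral_frac_kernel// -[RHS](integralDr (- x))//.
by apply: measurableT_comp => //; exact: measurable_frac_kernel.
Qed.

Let int_kb z : (\int[mu]_y (kb (z - y))%:E = (frac_power alpha (b - a))%:E)%E.
Proof.
rewrite -integral_frac_kernel// -[RHS](integral_reflect z)//.
by apply: measurableT_comp => //; exact: measurable_frac_kernel.
Qed.

Let mka x : measurable_fun setT (fun y => ka (y - x)).
Proof. by apply: measurableT_comp (measurable_frac_kernel _ _) _; exact: measurable_funB. Qed.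

Let mkb z : measurable_fun setT (fun y => kb (z - y)).
Proof. by apply: measurableT_comp (measurable_frac_kernel _ _) _; exact: measurable_funB. Qed.

Let Ka_bound x : (\int[mu]_y `|Ka x y|%:E <= (frac_power (1 - alpha) (b - a))%:E)%E.
Proof.
rewrite -(int_ka x); apply: ge0_le_integral_fun => //.
- exact: (measurable_pair1 x mKa).
- by move=> y; rewrite Ka_ge0 ler_piMr ?frac_kernel_ge0.
Qed.

Let Kh_bound x : (\int[mu]_y `|Kh x y|%:E <= (b - a)%:E)%E.
Proof.
apply: (@le_trans _ _ (\int[mu]_y (\1_Omega y)%:E)%E).
  apply: ge0_le_integral_fun => //; first exact: (measurable_pair1 x mKh).
  by move=> y; rewrite Kh_ge0 ler_piMl ?heavisideE// lern1 leq_b1.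
rewrite integral_indic//; last exact: measurable_itv.
rewrite setIT; apply: (@le_trans _ _ (mu Omega)) => //.
by rewrite /Omega lebesgue_measure_itv/= lte_fin ab EFinB.
Qed.

Lemma test_density_indic psi y : test_density a b psi -> \1_Omega y * psi y = psi y.
Proof.
move=> [_ [s [t [as_ tb pst]]] _]; have [->|/pst/andP[sy yt]] := eqVneq (psi y) 0.
  by rewrite mulr0.
by rewrite indicE mem_setE in_itv/= (lt_le_trans as_ sy) (le_lt_trans yt tb) mul1r.
Qed.

Let between x y z : a < x -> 0 < y - x -> 0 < z - y -> z <= b -> a < y < b.
Proof. by move=> *; apply/andP; split; lra. Qed.

Section representation.
Variables (c : R) (u v : R -> R).
Hypotheses (iu : L1 u) (iv : L1 v) (su : supported u) (sv : supported v).
Hypothesis weak : weak_identity c u v.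

Let F y := \int[mu]_x (u x * Ka x y).
Let V y := \int[mu]_x (v x * Kh x y).

Let iF : L1 F. Proof. by have [] := Fubini_kernel iu mKa Ka_bound. Qed.
Let iV : L1 V. Proof. by have [] := Fubini_kernel iv mKh Kh_bound. Qed.

Let iG : L1 (fun y => 1 * F y + (- c) * V y).
Proof. exact: integrable_lin. Qed.

(** Fubini moves the kernels from [psi] onto [u] and [v], so the weak identity says that [F - c V]
    is orthogonal to every test density. *)
Let orth psi : test_density a b psi ->
  \int[mu]_y ((1 * F y + (- c) * V y) * psi y) = 0.
Proof.
move=> dpsi; have [C psiC] := test_density_bounded dpsi.
have mpsi := L1_measurable (test_density_integrable dpsi).
have [iFp eF] := Fubini_kernel_mul iu mKa Ka_bound mpsi
  (kernel_mul_bound (fun x => measurable_pair1 x mKa) Ka_bound mpsi psiC).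
have [iVp eV] := Fubini_kernel_mul iv mKh Kh_bound mpsi
  (kernel_mul_bound (fun x => measurable_pair1 x mKh) Kh_bound mpsi psiC).
have := weak dpsi.
under eq_Rintegral => x _.
  under eq_Rintegral => y _ do rewrite -(test_density_indic y dpsi) mulrA.
  over.
under [RHS]eq_Rintegral => x _.
  under eq_Rintegral => y _ do rewrite -(test_density_indic y dpsi) mulrA.
  over.
rewrite eV eF => h.
transitivity (\int[mu]_y (1 * (F y * psi y) + (- c) * (V y * psi y))).
  by apply: eq_Rintegral => y _; ring.
by rewrite Rintegral_lin// mul1r mulNr h subrr.
Qed.

Let FVK : exists K, {ae mu, forall y, F y = c * V y + K * \1_Omega y}.
Proof.
have [K HK] := orthogonal_densities_const ab iG orth.
exists K.
have iK : L1 (fun y => 1 * (1 * F y + (- c) * V y) + (- K) * \1_Omega y).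
  by apply: integrable_lin => //; exact: integrable_indic_itv.
have := ae_eq0_itv iK (a := a) (b := b); move=> H.
have /H : forall z, a < z < b ->
  \int[mu]_x ((1 * (1 * F x + - c * V x) + - K * \1_Omega x) * \1_`]a, z[ x) = 0.
  move=> z /andP[az zb].
  transitivity (\int[mu]_x (1 * ((1 * F x + - c * V x) * \1_(`]a, z[) x) +
     (- K) * \1_(`]a, z[) x)).
    apply: eq_Rintegral => x _; rewrite mulrDl -!mulrA; congr (_ + _ * _).
    rewrite !indicE !mem_setE !in_itv/=.
    by case: (ltP a x) => ax/=; case: (ltP x z) => xz/=; rewrite ?mulr0// (lt_trans xz zb) mulr1.
  rewrite Rintegral_lin; last 2 first.
  - apply: le_integrable_norm (integrable_norm iG).
      by apply: measurable_funM; [exact: L1_measurable iG|exact: measurable_indic].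
    by move=> x; rewrite normrM ler_piMr// ger0_norm.
  - exact: integrable_indic_itv.
  rewrite HK ?az//.
  rewrite [X in _ + _ * X]/Rintegral integral_indic//= setIT lebesgue_measure_itv/=.
  by rewrite lte_fin az -EFinD/=; ring.
apply: ae_imply => y hy; have [yab|yab] := boolP (a < y < b).
  have := hy yab; rewrite indicE mem_setE in_itv/= yab; lra.
(* Outside [Omega] the cut-off annihilates all three terms, so the identity holds almost everywhere
   on the line and can be integrated over it. *)
have y0 : \1_Omega y = 0 :> R by rewrite indicE mem_setE in_itv/= (negbTE yab).
rewrite y0 /F /V.
have -> : \int[mu]_x (u x * Ka x y) = \int[mu]_x (cst 0 x : R).
  by apply: eq_Rintegral => x _; rewrite /Ka y0 !mulr0.
have -> : \int[mu]_x (v x * Kh x y) = \int[mu]_x (cst 0 x : R).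
  by apply: eq_Rintegral => x _; rewrite /Kh y0 !mulr0.
by rewrite Rintegral_cst// mul0r !mulr0 addr0.
Qed.

(** The identity [F = c V + K] on [Omega] is integrated against [kb (z - y)]. By the Beta integral,
    the composition of both kernels is [B] times the Heaviside function, so this yields the
    primitive of [u], not [u] itself, and at every z of the closed interval. The term in K becomes
    the primitive of the singular function. *)
Lemma abel_representation B : 0 < B ->
  (forall L x z, z - x <= L ->
  (\int[mu]_y (frac_kernel (1 - alpha) L (y - x) * frac_kernel alpha L (z - y))%:E =
   (B * heaviside (z - x))%:E)%E) -> exists K, forall z, a <= z <= b ->
  B * \int[mu]_x (u x * heaviside (z - x)) =
  K * frac_power alpha (z - a) + c * \int[mu]_x (v x * frac_power alpha (z - x)).
Proof.
move=> B0 beta; have [K HK] := FVK; exists K => z /andP[az zb].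
have w0 y : 0 <= kb (z - y) by exact: frac_kernel_ge0.
have bound1 x : (\int[mu]_y `|Ka x y * kb (z - y)|%:E <= B%:E)%E.
  (* Here x ranges over the whole line and z - x may exceed b - a. Kernels increase with the
     truncation level, so it is raised until [beta] applies. *)
  pose L := Num.max (b - a) (z - x).
  apply: (@le_trans _ _ (B * heaviside (z - x))%:E); last first.
    by rewrite lee_fin ler_piMr ?(ltW B0)// heaviside_le1.
  rewrite -(beta L) ?le_max ?lexx ?orbT//; apply: ge0_le_integral_fun.
  - by apply: measurable_funM => //; exact: (measurable_pair1 x mKa).
  - apply: measurable_funM.
      by apply: measurableT_comp (measurable_frac_kernel _ _) _; exact: measurable_funB.
    by apply: measurableT_comp (measurable_frac_kernel _ _) _; exact: measurable_funB.
  - move=> y; rewrite mulr_ge0//= ler_pM//.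
      by rewrite (le_trans (Ka_le _ _))// frac_kernel_le// le_max lexx.
    by rewrite frac_kernel_le// le_max lexx.
have bound2 x : (\int[mu]_y `|Kh x y * kb (z - y)|%:E <=
    (frac_power alpha (b - a))%:E)%E.
  rewrite -(int_kb z); apply: ge0_le_integral_fun => //.
    by apply: measurable_funM => //; exact: (measurable_pair1 x mKh).
  by move=> y; rewrite mulr_ge0//= ler_piMl.
have [i1 e1] := Fubini_kernel_mul iu mKa Ka_bound (mkb z) bound1.
have [i2 e2] := Fubini_kernel_mul iv mKh Kh_bound (mkb z) bound2.
have i3 : L1 (fun y => \1_Omega y * kb (z - y)).
  apply: (@le_integrable_norm _ _ (fun y => kb (z - y))).
  - exact: measurable_funM.
  - by move=> y; rewrite normrM !ger0_norm// ler_piMl.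
  - by apply: integrable_reflect; exact: frac_kernel_integrable.
have lhs : B * \int[mu]_x (u x * heaviside (z - x)) =
    \int[mu]_x (u x * \int[mu]_y (Ka x y * kb (z - y))).
  rewrite -RintegralZl_setT; last first.
    apply: le_integrable_norm (integrable_norm iu).
      apply: measurable_funM; first exact: L1_measurable.
      by apply: measurableT_comp measurable_heaviside _; exact: measurable_funB.
    by move=> x; rewrite normrM ler_piMr// ger0_norm ?heaviside_ge0// heaviside_le1.
  apply: eq_Rintegral => x _; have [/andP[ax xb]|xab] := boolP (a < x < b); last first.
    by rewrite (su xab) !mul0r mulr0.
  rewrite mulrCA; congr (_ * _).
  rewrite -[LHS]/(fine (_)%:E) -(beta (b - a)); last by rewrite lerB// ltW.
  congr fine; apply: eq_integral => y _; congr (_%:E).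
  rewrite /Ka /ka /kb indicE mem_setE in_itv/= !frac_kernelE.
  case: ifPn => [/andP[h1 h2]|]; last by rewrite !mul0r.
  case: ifPn => [/andP[h3 h4]|]; last by rewrite !mulr0.
  by rewrite (between ax _ _ zb) ?mulr1.
have rhs1 : \int[mu]_x (v x * frac_power alpha (z - x)) =
    \int[mu]_x (v x * \int[mu]_y (Kh x y * kb (z - y))).
  apply: eq_Rintegral => x _; have [/andP[ax xb]|xab] := boolP (a < x < b); last first.
    by rewrite (sv xab) !mul0r.
  congr (_ * _); rewrite -[LHS]/(fine (_)%:E).
  rewrite -(@integral_frac_kernel_heaviside _ _ (b - a))//; last by rewrite lerB// ltW.
  congr fine; apply: eq_integral => y _; congr (_%:E).
  rewrite /Kh /kb indicE mem_setE in_itv/= !frac_kernelE heavisideE.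
  case: ltP => [h1|]; last by rewrite !mul0r.
  case: ifPn => [/andP[h3 h4]|]; last by rewrite !mulr0.
  by rewrite (between ax _ _ zb) ?mulr1.
have rhs2 : \int[mu]_y (\1_Omega y * kb (z - y)) = frac_power alpha (z - a).
  rewrite -[RHS]/(fine (_)%:E).
  rewrite -(@integral_frac_kernel_heaviside _ _ (b - a))//; last by rewrite lerB.
  congr fine; apply: eq_integral => y _; congr (_%:E).
  rewrite /kb indicE mem_setE in_itv/= !frac_kernelE heavisideE.
  case: ifPn => [/andP[h3 h4]|]; last by rewrite !mulr0.
  by rewrite subr_gt0 (_ : y < b) ?andbT// (lt_le_trans _ zb)// -subr_gt0.
rewrite lhs e1 rhs1 e2 -rhs2.
transitivity (\int[mu]_y (K * (\1_Omega y * kb (z - y)) + c * (V y * kb (z - y)))).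
  apply: ae_eq_Rintegral.
  - exact: L1_measurable i1.
  - by apply: L1_measurable; exact: integrable_lin.
  - by apply: ae_imply HK => y; rewrite /F => ->; ring.
exact: Rintegral_lin.
Qed.

End representation.
End abel_equation.

(** * Exchange of the two one-sided identities by reflection *)

Section reflection.
Context {R : realType}.
Local Notation mu := (@lebesgue_measure R).
Local Notation L1 f := (mu.-integrable setT (EFin \o f)).
Variables (a b alpha : R).
Implicit Types (u v w psi k : R -> R) (x y z c : R).

(** For a test function [phi] with derivative [psi] and c = Gamma (1 - alpha), the inner integrals
    are now [phi x] and [c * left_frac_deriv alpha phi x], without the minus signs of the left
    identity. *)
Definition weak_identity_right c u w := forall psi, test_density a b psi ->
  c * \int[mu]_x (w x * \int[mu]_y (heaviside (x - y) * psi y)) =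
  \int[mu]_x (u x * \int[mu]_y (frac_kernel (1 - alpha) (b - a) (x - y) * psi y)).

Let r x := a + b - x.

Lemma reflect_form w k psi (M : R) : L1 w -> measurable_fun setT k ->
  measurable_fun setT psi ->
  (forall x, \int[mu]_y `|k (x - y) * psi (r y)|%:E <= M%:E)%E ->
  \int[mu]_x (w (r x) * \int[mu]_y (k (y - x) * psi y)) =
  \int[mu]_x (w x * \int[mu]_y (k (x - y) * psi (r y))).
Proof.
move=> iw mk mpsi kM.
have mK : measurable_fun setT (fun p : R * R => k (p.1 - p.2) * psi (r p.2)).
  apply: measurable_funM; first by apply: measurableT_comp mk _; exact: measurable_funB.
  apply: measurableT_comp mpsi _; apply: measurable_funB => //.
(* Fubini supplies the measurability of the outer integrand, which the change of variables
   requires. *)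
have [i1 _ _ _] := @Fubini_kernel R w (fun x y => k (x - y) * psi (r y)) M iw mK kM.
rewrite -(Rintegral_reflect (a + b) (L1_measurable i1)).
apply: eq_Rintegral => x _; congr (_ * _).
rewrite -(@Rintegral_reflect _ (a + b)); last first.
  by apply: measurable_funM => //; apply: measurableT_comp mk _; exact: measurable_funB.
apply: eq_Rintegral => y _; congr (k _ * _); rewrite /r; ring.
Qed.

Lemma reflect_formN w k psi (M : R) : L1 w -> measurable_fun setT k ->
  measurable_fun setT psi ->
  (forall x, \int[mu]_y `|k (- (x - y)) * psi (r y)|%:E <= M%:E)%E ->
  \int[mu]_x (w (r x) * \int[mu]_y (k (x - y) * psi y)) =
  \int[mu]_x (w x * \int[mu]_y (k (y - x) * psi (r y))).
Proof.
move=> iw mk mpsi kM.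
have mkN : measurable_fun setT (fun t : R => k (- t)).
  by apply: measurableT_comp mk _; exact: oppr_measurable.
have := reflect_form iw mkN mpsi kM.
have e w' (f g : R -> R -> R) : (forall x y, f x y = g x y) ->
    \int[mu]_x (w' x * \int[mu]_y f x y) = \int[mu]_x (w' x * \int[mu]_y g x y).
  by move=> fg; have -> : f = g by apply/funext => x; apply/funext => y.
rewrite (e (fun x => w (r x)) _ (fun x y => k (x - y) * psi y)); last first.
  by move=> x y; rewrite opprB.
rewrite (e w _ (fun x y => k (y - x) * psi (r y)))//.
by move=> x y; rewrite opprB.
Qed.

Lemma supported_reflect u : supported a b u -> supported a b (u \o r).
Proof.
move=> su x xab; apply: su; apply: contra xab => /andP[h1 h2]; rewrite /r in h1 h2.
by apply/andP; split; lra.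
Qed.

Let bound k psi (M C : R) : measurable_fun setT k -> (forall t, 0 <= k t) ->
  (\int[mu]_t (k t)%:E <= M%:E)%E -> measurable_fun setT psi ->
  (forall x, `|psi x| <= C) -> forall x, (\int[mu]_y `|k (x - y) * psi (r y)|%:E <= (C * M)%:E)%E.
Proof.
move=> mk k0 kM mpsi psiC x.
apply: (@kernel_mul_bound _ (fun x y => k (x - y)) M C (fun y => psi (r y))) => //.
- by move=> {}x; apply: measurableT_comp mk _; exact: measurable_funB.
- move=> {}x; under eq_integral do rewrite ger0_norm//.
  by rewrite (@integral_reflect _ x (EFin \o k))//; exact/measurable_EFinP.
- by apply: measurableT_comp mpsi _; exact: measurable_reflect.
Qed.

(** The Heaviside function is not integrable, so the mass is bounded through that of [psi]. The sign
    [s] is 1 or -1 according to the orientation of the kernel. *)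
Let bound1 psi (C : R) : L1 psi -> (forall t, `|psi t| <= C) ->
  forall x s, (\int[mu]_y `|heaviside (s * (x - y)) * psi (r y)|%:E <=
    (\int[mu]_y `|psi y|)%:E)%E.
Proof.
move=> ipsi psiC x s; have mpsi := L1_measurable ipsi.
rewrite EFin_Rintegral; last exact: integrable_norm.
rewrite -[leRHS](integral_reflect (a + b)); last first.
  by apply/measurable_EFinP; exact: measurableT_comp.
apply: ge0_le_integral => //.
- apply/measurable_EFinP; apply: measurableT_comp => //; apply: measurable_funM.
    apply: measurableT_comp measurable_heaviside _; apply: measurable_funM => //.
    exact: measurable_funB.
  by apply: measurableT_comp mpsi _; exact: measurable_reflect.
- apply/measurable_EFinP; apply: measurableT_comp => //.
  by apply: measurableT_comp mpsi _; exact: measurable_reflect.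
- move=> y _; rewrite lee_fin normrM ler_piMl// ger0_norm ?heaviside_ge0//.
  exact: heaviside_le1.
Qed.

Hypothesis alpha1 : 0 < 1 - alpha.

Let ikN : (\int[mu]_t (frac_kernel (1 - alpha) (b - a) (- t))%:E <=
  (frac_power (1 - alpha) (b - a))%:E)%E.
Proof.
rewrite (@integral_oppr _ (EFin \o frac_kernel (1 - alpha) (b - a))).
  by rewrite integral_frac_kernel.
by apply/measurable_EFinP; exact: measurable_frac_kernel.
Qed.

Lemma weak_identity_reflect c u v : L1 u -> L1 v ->
  weak_identity a b alpha c u v -> weak_identity_right c (u \o r) (v \o r).
Proof.
move=> iu iv H psi dpsi; have dpsir := test_density_reflect dpsi.
have [C psiC] := test_density_bounded dpsi.
have ipsi := test_density_integrable dpsi; have mpsi := L1_measurable ipsi.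
have := H _ dpsir.
have mkN : measurable_fun setT (fun t : R => frac_kernel (1 - alpha) (b - a) (- t)).
  by apply: measurableT_comp (measurable_frac_kernel _ _) _; exact: oppr_measurable.
have b1 x : (\int[mu]_y `|heaviside (- (x - y)) * psi (r y)|%:E <=
    (\int[mu]_y `|psi y|)%:E)%E.
  by have := bound1 ipsi psiC x (-1); under eq_integral do rewrite mulN1r.
rewrite (reflect_formN iv measurable_heaviside mpsi b1).
rewrite (reflect_formN iu (measurable_frac_kernel _ _) mpsi
  (bound mkN (fun t => frac_kernel_ge0 _ _ _) ikN mpsi psiC)).
by move=> ->.
Qed.

Lemma weak_identity_right_reflect c u w : L1 u -> L1 w ->
  weak_identity_right c u w -> weak_identity a b alpha c (u \o r) (w \o r).
Proof.
move=> iu iw H psi dpsi; have dpsir := test_density_reflect dpsi.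
have [C psiC] := test_density_bounded dpsi.
have ipsi := test_density_integrable dpsi; have mpsi := L1_measurable ipsi.
have b1 x : (\int[mu]_y `|heaviside (x - y) * psi (r y)|%:E <=
    (\int[mu]_y `|psi y|)%:E)%E.
  by have := bound1 ipsi psiC x 1; under eq_integral do rewrite mul1r.
rewrite (reflect_form iw measurable_heaviside mpsi b1).
have ik : (\int[mu]_t (frac_kernel (1 - alpha) (b - a) t)%:E <=
  (frac_power (1 - alpha) (b - a))%:E)%E by rewrite integral_frac_kernel.
have mk := measurable_frac_kernel (1 - alpha) (b - a).
rewrite (reflect_form iu mk mpsi (bound mk (fun t => frac_kernel_ge0 _ _ _) ik mpsi psiC)).
exact: H.
Qed.

End reflection.

(** * The boundary term *)

Section boundary_term.
Context {R : realType}.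
Local Notation mu := (@lebesgue_measure R).
Local Notation L1 f := (mu.-integrable setT (EFin \o f)).
Variables (a b alpha : R).
Hypotheses (ab : a < b) (alpha01 : 0 < alpha < 1).
Implicit Types (u v w : R -> R) (x y z c t e : R).

Let alpha0 : 0 < alpha. Proof. by case/andP: alpha01. Qed.
Let alpha1 : 0 < 1 - alpha. Proof. by rewrite subr_gt0; case/andP: alpha01. Qed.

Let powR_le1 (q s : R) : 0 <= q -> q <= 1 -> 0 <= s -> q `^ s <= 1.
Proof.
move=> q0 q1 s0; have -> : 1 = 1 `^ s :> R by rewrite powR1.
by rewrite ge0_ler_powR ?nnegrE.
Qed.

Let powR_ge1 (q s : R) : 1 <= q -> 0 <= s -> 1 <= q `^ s.
Proof.
move=> q1 s0; have {1}-> : 1 = 1 `^ s :> R by rewrite powR1.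
by rewrite ge0_ler_powR ?nnegrE// (le_trans _ q1).
Qed.

Lemma frac_power_pos t : 0 < t -> frac_power alpha t = t `^ alpha / alpha.
Proof. by move=> t0; rewrite /frac_power heavisideE t0 mul1r. Qed.

Lemma frac_power_npos t : t <= 0 -> frac_power alpha t = 0.
Proof. by move=> t0; rewrite /frac_power heavisideE ltNge t0/= !mul0r. Qed.

Lemma frac_power_le t t' : t <= t' -> frac_power alpha t <= frac_power alpha t'.
Proof.
move=> tt; have [t0|t0] := ltP 0 t; last by rewrite frac_power_npos// frac_power_ge0.
rewrite !frac_power_pos// ?(lt_le_trans t0 tt)//.
rewrite ler_pM2r ?invr_gt0// ge0_ler_powR ?nnegrE ?(ltW alpha0) ?(ltW t0)//.
by rewrite ltW// (lt_le_trans t0 tt).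
Qed.

(* Stated so as to display the increment as [o(e^alpha)] for fixed [t]. *)
Lemma frac_power_increment t e : 0 < t -> 0 < e ->
  frac_power alpha t - frac_power alpha (t - e) <=
  e `^ alpha / alpha * (e / t) `^ (1 - alpha).
Proof.
move=> t0 e0; have ea0 : 0 <= e `^ alpha / alpha by rewrite divr_ge0 ?powR_ge0 ?ltW.
have [te|et] := leP t e.
  rewrite (frac_power_npos (_ : t - e <= 0)); last by rewrite subr_le0.
  rewrite subr0 frac_power_pos//; apply: (@le_trans _ _ (e `^ alpha / alpha)).
    rewrite ler_pM2r ?invr_gt0// ge0_ler_powR ?nnegrE ?(ltW alpha0) ?(ltW t0)//.
    exact: ltW.
  by rewrite ler_peMr// powR_ge1 ?(ltW alpha1)// ler_pdivlMr ?mul1r.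
rewrite !frac_power_pos ?subr_gt0// -mulrBl mulrAC ler_pM2r ?invr_gt0//.
have et1 : 0 < 1 - e / t by rewrite subr_gt0 ltr_pdivrMr// mul1r.
have -> : (t - e) `^ alpha = t `^ alpha * (1 - e / t) `^ alpha.
  by rewrite -powRM ?(ltW t0) ?(ltW et1)//; congr (_ `^ _); field; rewrite gt_eqF.
(* With q = e / t in (0, 1), the inequality 1 - q <= (1 - q)^alpha bounds the difference of powers
   by t^alpha q, which equals e^alpha q^(1 - alpha). *)
have le1 : 1 - e / t <= (1 - e / t) `^ alpha.
  rewrite ger1_powR ?et1//=; first by rewrite gerBl divr_ge0 ?ltW.
  by rewrite -subr_ge0 ltW.
have -> : e `^ alpha * (e / t) `^ (1 - alpha) = t `^ alpha * (e / t).
  have -> : e `^ alpha = t `^ alpha * (e / t) `^ alpha.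
    by rewrite -powRM ?(ltW t0) ?divr_ge0 ?ltW//; congr (_ `^ _); field; rewrite gt_eqF.
  rewrite -mulrA -powRD; last first.
    by rewrite mulf_neq0 ?implybT ?invr_eq0 ?gt_eqF.
  by rewrite addrCA subrr addr0 powRr1// divr_ge0 ?ltW.
rewrite -{1}[t `^ alpha]mulr1 -mulrBr ler_wpM2l ?powR_ge0//; lra.
Qed.

(** Division by e^alpha turns the singular term K e^alpha / alpha into the constant K / alpha. The
    quotients [D] and [E] are bounded by 1 / alpha and tend to 0 with e for each fixed t > 0, as
    dominated convergence demands. *)
Let D t e := (frac_power alpha t - frac_power alpha (t - e)) / (e `^ alpha).
Let E t e := frac_power alpha (e - t) / (e `^ alpha).

Let D_ge0 t e : 0 < e -> 0 <= D t e.
Proof. by move=> e0; rewrite divr_ge0 ?powR_ge0// subr_ge0 frac_power_le// gerBl ltW. Qed.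

Let D_le t e : 0 < t -> 0 < e -> D t e <= alpha^-1 * (e / t) `^ (1 - alpha).
Proof.
move=> t0 e0; rewrite ler_pdivrMr ?powR_gt0// (le_trans (frac_power_increment t0 e0))//.
by rewrite -subr_ge0 le_eqVlt; apply/orP; left; apply/eqP; ring.
Qed.

Let D_le1 t e : 0 < t -> 0 < e -> D t e <= alpha^-1.
Proof.
move=> t0 e0; have ea := powR_gt0 alpha e0.
have [te|et] := leP t e; last first.
  rewrite (le_trans (D_le t0 e0))// ler_piMr ?invr_ge0 ?(ltW alpha0)//.
  by rewrite powR_le1 ?(ltW alpha1) ?divr_ge0 ?(ltW e0) ?(ltW t0)// ler_pdivrMr ?mul1r ?ltW.
rewrite /D (frac_power_npos (_ : t - e <= 0)); last by rewrite subr_le0.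
rewrite subr0 frac_power_pos// ler_pdivrMr// mulrC ler_pM2l ?invr_gt0//.
by rewrite ge0_ler_powR ?nnegrE ?(ltW alpha0) ?(ltW t0)// ltW.
Qed.

Let E_ge0 t e : 0 <= E t e.
Proof. by rewrite divr_ge0 ?powR_ge0// frac_power_ge0. Qed.

Let E_le1 t e : 0 <= t -> 0 < e -> E t e <= alpha^-1.
Proof.
move=> t0 e0; rewrite ler_pdivrMr ?powR_gt0// (@le_trans _ _ (frac_power alpha e))//.
  by rewrite frac_power_le// gerBl.
by rewrite frac_power_pos// mulrC.
Qed.

Section sequence.
Variable (e_ : nat -> R).
Hypotheses (e0 : forall n, 0 < e_ n) (ecvg : e_ n @[n --> \oo] --> (0:R)).

Let D_cvg t : 0 < t -> D t (e_ n) @[n --> \oo] --> (0:R).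
Proof.
move=> t0.
have ec : e_ n / t @[n --> \oo] --> (0:R).
  by rewrite -(mul0r t^-1); apply: cvgM => //; exact: cvg_cst.
have pc : (e_ n / t) `^ (1 - alpha) @[n --> \oo] --> (0:R).
  move/cvg_at_rightP : (powR_cvg0 alpha1); apply; split => // n.
  by rewrite divr_gt0.
apply: (@squeeze_cvgr _ _ _ _ (cst 0) (fun n => alpha^-1 * (e_ n / t) `^ (1 - alpha))).
- by apply: nearW => n; rewrite D_ge0//= D_le.
- exact: cvg_cst.
- by rewrite -(mulr0 alpha^-1); apply: cvgM => //; exact: cvg_cst.
Qed.

Let E_cvg t : 0 < t -> E t (e_ n) @[n --> \oo] --> (0:R).
Proof.
move=> t0; apply: (@cvg_trans _ ((cst 0 : nat -> R) @ \oo)); last exact: cvg_cst.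
apply: near_eq_cvg; near=> n; rewrite /E frac_power_npos ?mul0r// subr_le0 ltW//.
by near: n; exact: (cvgr_lt 0).
Unshelve. all: by end_near. Qed.

Let mfp f : measurable_fun setT f -> measurable_fun setT (fun x : R => frac_power alpha (f x)).
Proof. by move=> mf; exact: measurableT_comp (measurable_frac_power _) mf. Qed.

Let cvg_int v (K : R -> R -> R) : L1 v -> supported a b v ->
  (forall e, measurable_fun setT (K ^~ e)) ->
  (forall x n, a < x -> 0 <= K x (e_ n) <= alpha^-1) ->
  (forall x, a < x -> K x (e_ n) @[n --> \oo] --> (0:R)) ->
  \int[mu]_x (v x * K x (e_ n)) @[n --> \oo] --> (0:R).
Proof.
move=> iv sv mK K01 Kc.
have -> : (0 : R) = \int[mu]_x (cst 0 x : R) by rewrite Rintegral_cst// mul0r.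
have mv := L1_measurable iv.
apply: (@dominated_cvg_Rintegral _ _ _ (fun x => alpha^-1 * `|v x|)).
- by move=> n; apply: measurable_funM.
- exact: (integrableZl measurableT alpha^-1 (integrable_norm iv)).
- move=> n x; have [/andP[ax xb]|xab] := boolP (a < x < b); last first.
    by rewrite (sv _ xab) mul0r normr0 mulr0.
  have /andP[K0 K1] := K01 x n ax.
  by rewrite normrM mulrC ler_wpM2r// ger0_norm.
- move=> x; have [/andP[ax xb]|xab] := boolP (a < x < b); last first.
    by rewrite (sv _ xab); under eq_fun do rewrite mul0r; exact: cvg_cst.
  by rewrite -(mulr0 (v x)); apply: cvgM; [exact: cvg_cst|exact: Kc].
Qed.

Let mD e : measurable_fun setT (fun x => D (x - a) e).
Proof.
apply: measurable_funM => //; apply: measurable_funB; apply: mfp => //.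
  exact: measurable_funB.
by apply: measurable_funB => //; exact: measurable_funB.
Qed.

Let mE e : measurable_fun setT (fun x => E (x - a) e).
Proof.
apply: measurable_funM => //; apply: mfp => //.
by apply: measurable_funB => //; exact: measurable_funB.
Qed.

(* After division by [e_ n `^ alpha], the right-hand side tends to [0] by dominated
   convergence. *)
Lemma boundary_term_eq0 K K' v w c : L1 v -> L1 w -> supported a b v -> supported a b w ->
  (forall n, K * frac_power alpha (e_ n) =
    K' * (frac_power alpha (b - a) - frac_power alpha (b - a - e_ n)) +
    c * \int[mu]_x (w x * (frac_power alpha (x - a) - frac_power alpha (x - a - e_ n))) -
    c * \int[mu]_x (v x * frac_power alpha (e_ n - (x - a)))) ->
  K = 0.
Proof.
move=> iv iw sv sw eqn.
have eq' n : K / alpha = K' * D (b - a) (e_ n) +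
    c * \int[mu]_x (w x * D (x - a) (e_ n)) - c * \int[mu]_x (v x * E (x - a) (e_ n)).
  have p0 : 0 < e_ n `^ alpha by rewrite powR_gt0.
  have -> : \int[mu]_x (w x * D (x - a) (e_ n)) =
    (e_ n `^ alpha)^-1 * \int[mu]_x (w x * (frac_power alpha (x - a) - frac_power alpha (x - a - e_ n))).
    rewrite -RintegralZl_setT; last first.
      apply: (@le_integrable_norm _ _ (fun x => e_ n `^ alpha / alpha * `|w x|)).
      - apply: measurable_funM; first exact: L1_measurable.
        apply: measurable_funB; apply: mfp; first exact: measurable_funB.
        by apply: measurable_funB => //; exact: measurable_funB.
      - move=> x; have [/andP[ax xb]|xab] := boolP (a < x < b); last first.
          by rewrite (sw _ xab) mul0r normr0 mulr0.
        rewrite normrM mulrC ler_wpM2r// ger0_norm.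
          have := D_le1 (_ : 0 < x - a) (e0 n); rewrite subr_gt0 => /(_ ax).
          by rewrite /D ler_pdivrMr// mulrC.
        by rewrite subr_ge0 frac_power_le// gerBl ltW.
      - exact: (integrableZl measurableT (e_ n `^ alpha / alpha) (integrable_norm iw)).
    by apply: eq_Rintegral => x _; rewrite /D; ring.
  have -> : \int[mu]_x (v x * E (x - a) (e_ n)) =
    (e_ n `^ alpha)^-1 * \int[mu]_x (v x * frac_power alpha (e_ n - (x - a))).
    rewrite -RintegralZl_setT; last first.
      apply: (@le_integrable_norm _ _ (fun x => e_ n `^ alpha / alpha * `|v x|)).
      - apply: measurable_funM; first exact: L1_measurable.
        by apply: mfp; apply: measurable_funB => //; exact: measurable_funB.
      - move=> x; have [/andP[ax xb]|xab] := boolP (a < x < b); last first.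
          by rewrite (sv _ xab) mul0r normr0 mulr0.
        rewrite normrM mulrC ler_wpM2r// ger0_norm ?frac_power_ge0//.
        have := E_le1 (_ : 0 <= x - a) (e0 n); rewrite subr_ge0 => /(_ (ltW ax)).
        by rewrite /E ler_pdivrMr// mulrC.
      - exact: (integrableZl measurableT (e_ n `^ alpha / alpha) (integrable_norm iv)).
    by apply: eq_Rintegral => x _; rewrite /E; ring.
  have := eqn n; rewrite frac_power_pos// /D.
  set X := Rintegral _ _ _; set Y := Rintegral _ _ _.
  move=> h; have p1 : e_ n `^ alpha != 0 by rewrite gt_eqF.
  apply: (mulfI p1); rewrite mulrCA h.
  by field.
have l1 : (K' * D (b - a) (e_ n) + c * \int[mu]_x (w x * D (x - a) (e_ n)) -
    c * \int[mu]_x (v x * E (x - a) (e_ n))) @[n --> \oo] --> (K' * 0 + c * 0 - c * 0 : R).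
  apply: cvgB; [apply: cvgD|]; apply: cvgM; try exact: cvg_cst.
  - by apply: D_cvg; rewrite subr_gt0.
  - apply: (cvg_int iw sw mD).
      by move=> x n ax; rewrite D_ge0//= D_le1// subr_gt0.
    by move=> x ax; apply: D_cvg; rewrite subr_gt0.
  - apply: (cvg_int iv sv mE).
      by move=> x n ax; rewrite E_ge0//= E_le1// subr_ge0 ltW.
    by move=> x ax; apply: E_cvg; rewrite subr_gt0.
have l2 : (K / alpha : R) @[_ --> \oo] --> (K' * 0 + c * 0 - c * 0 : R).
  by rewrite (funext eq').
have l3 : (K / alpha : R) @[_ --> \oo] --> (K / alpha : R) by exact: cvg_cst.
have : K' * 0 + c * 0 - c * 0 = K / alpha by exact: (cvg_unique (@Rhausdorff R) l2 l3).
rewrite !mulr0 addr0 subr0 => /esym/eqP; rewrite mulf_eq0 invr_eq0 (gt_eqF alpha0) orbF.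
by move/eqP.
Qed.

End sequence.
End boundary_term.

(** * Inversion *)

Section inversion.
Context {R : realType}.
Local Notation mu := (@lebesgue_measure R).
Local Notation L1 f := (mu.-integrable setT (EFin \o f)).
Variables (a b alpha : R).
Hypotheses (ab : a < b) (alpha01 : 0 < alpha < 1).
Implicit Types (u v w : R -> R) (x y z c : R).

Let alpha0 : 0 < alpha. Proof. by case/andP: alpha01. Qed.
Let alpha1 : 0 < 1 - alpha. Proof. by rewrite subr_gt0; case/andP: alpha01. Qed.

Let r x := a + b - x.

Let L1_mul u (f : R -> R) (M : R) : L1 u -> supported a b u -> measurable_fun setT f ->
  (forall x, a < x < b -> 0 <= f x <= M) -> L1 (fun x => u x * f x).
Proof.
move=> iu su mf fM; apply: (@le_integrable_norm _ _ (fun x => M * `|u x|)).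
- by apply: measurable_funM => //; exact: L1_measurable.
- move=> x; have [xab|xab] := boolP (a < x < b); last by rewrite su// mul0r normr0 mulr0.
  have /andP[f0 f1] := fM x xab.
  by rewrite normrM mulrC ler_wpM2r// ger0_norm.
- exact: (integrableZl measurableT M (integrable_norm iu)).
Qed.

Let mhv (s : R) z : measurable_fun setT (fun x : R => heaviside (s * (z - x))).
Proof.
apply: measurableT_comp measurable_heaviside _; apply: measurable_funM => //.
exact: measurable_funB.
Qed.

Let mhv1 z : measurable_fun setT (fun x : R => heaviside (z - x)).
Proof. by have := mhv 1 z; under eq_fun do rewrite mul1r. Qed.

Let mhv2 z : measurable_fun setT (fun x : R => heaviside (x - z)).
Proof. by have := mhv (-1) z; under eq_fun do rewrite mulN1r opprB. Qed.

Let hv01 (t : R) : 0 <= heaviside t <= 1.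
Proof. by rewrite heaviside_ge0 heaviside_le1. Qed.

Let Rintegral_heaviside_split u z : L1 u -> supported a b u ->
  \int[mu]_x (u x * heaviside (z - x)) + \int[mu]_x (u x * heaviside (x - z)) =
  \int[mu]_x u x.
Proof.
move=> iu su; have i1 : L1 (fun x => u x * heaviside (z - x)) by exact: (@L1_mul _ _ 1).
have i2 : L1 (fun x => u x * heaviside (x - z)) by exact: (@L1_mul _ _ 1).
have := Rintegral_lin 1 1 i1 i2; rewrite !mul1r => <-.
apply: ae_eq_Rintegral.
- by apply: L1_measurable; exact: integrable_lin.
- exact: L1_measurable.
have : {ae mu, forall x, x != z}.
  exists [set z]; split => //; first exact: lebesgue_measure_set1.
  by move=> x /=; rewrite /= => /negP/negPn/eqP.
apply: ae_imply => x xz; rewrite !mul1r !heavisideE !subr_gt0.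
by case: ltgtP xz => // _ _; rewrite ?mulr1 ?mulr0 ?addr0 ?add0r.
Qed.

(** [U] and [U'] stand for the integrals of [u] to the left and to the right of a + e, and [U0] for
    the whole integral. Subtracting the right-sided formulas at [a] and at a + e gives a second
    expression of [B * U], to be compared with the left-sided one. *)
Let alg (B U U' U0 K K' c F0 F1 Fe V W0 W1 : R) : U + U' = U0 ->
  B * U0 = K' * F0 + c * W0 -> B * U' = K' * F1 + c * W1 ->
  B * U = K * Fe + c * V -> K * Fe = K' * (F0 - F1) + c * (W0 - W1) - c * V.
Proof.
move=> h h1 h2 h3.
have : B * U = B * U0 - B * U' by rewrite -h; ring.
rewrite h1 h2 h3 => e; rewrite -[LHS](addrK (c * V)) e; ring.
Qed.

Lemma abel_inversion B c u v w : 0 < B ->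
  (forall L x z, z - x <= L ->
  (\int[mu]_y (frac_kernel (1 - alpha) L (y - x) * frac_kernel alpha L (z - y))%:E =
   (B * heaviside (z - x))%:E)%E) ->
  L1 u -> L1 v -> L1 w -> supported a b u -> supported a b v -> supported a b w ->
  weak_identity a b alpha c u v -> weak_identity_right a b alpha c u w ->
  {ae mu, forall y, a < y < b ->
    B * u y = c * \int[mu]_x (v x * frac_kernel alpha (b - a) (y - x))}.
Proof.
move=> B0 beta iu iv iw su sv sw Wv Ww.
have [K HK] := abel_representation ab alpha01 iu iv su sv Wv B0 beta.
have Wr := weak_identity_right_reflect alpha1 iu iw Ww.
have [K' HK'] := abel_representation ab alpha01 (integrable_reflect (a + b) iu)
  (integrable_reflect (a + b) iw) (supported_reflect su) (supported_reflect sw) Wr B0 beta.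
(* The representation of the reflected function at [r z], carried back: it describes the integral of
   [u] over (z, b), with the singular term now at [b]. *)
have {}HK' z : a <= z <= b -> B * \int[mu]_x (u x * heaviside (x - z)) =
    K' * frac_power alpha (b - z) + c * \int[mu]_x (w x * frac_power alpha (x - z)).
  move=> /andP[az zb]; have : a <= r z <= b by rewrite /r; apply/andP; split; lra.
  move=> /HK'; rewrite (_ : r z - a = b - z); last by rewrite /r; ring.
  rewrite -(@Rintegral_reflect _ (a + b) (fun x => u x * heaviside (x - z))); last first.
    by apply: measurable_funM => //; exact: L1_measurable.
  rewrite -(@Rintegral_reflect _ (a + b) (fun x => w x * frac_power alpha (x - z))); last first.
    apply: measurable_funM; first exact: L1_measurable.
    by apply: measurableT_comp (measurable_frac_power _) _; exact: measurable_funB.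
  have e f (k : R -> R) : \int[mu]_x ((f \o (fun x => a + b - x)) x * k (r z - x)) =
      \int[mu]_x (f (a + b - x) * k (a + b - x - z)) :> R.
    by apply: eq_Rintegral => x _; congr (_ * k _); rewrite /r; ring.
  by rewrite !e.
pose e_ n := (b - a) * @harmonic R n.
have ba0 : 0 < b - a by rewrite subr_gt0.
have e0 n : 0 < e_ n by rewrite mulr_gt0 ?harmonic_gt0.
have eL n : e_ n <= b - a by rewrite /e_ ler_piMr ?(ltW ba0)// /harmonic/= invf_le1// ler1n.
have ec : e_ n @[n --> \oo] --> (0:R).
  by rewrite -(mulr0 (b - a)); apply: cvgM; [exact: cvg_cst|exact: cvg_harmonic].
have ifp f z : L1 f -> supported a b f -> a <= z -> L1 (fun x => f x * frac_power alpha (x - z)).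
  move=> if_ sf az; apply: (@L1_mul _ _ (frac_power alpha (b - a))) => //.
    by apply: measurableT_comp (measurable_frac_power _) _; exact: measurable_funB.
  by move=> x /andP[ax xb]; rewrite frac_power_ge0//= frac_power_le//; lra.
have K0 : K = 0.
  apply: (@boundary_term_eq0 _ a b alpha ab alpha01 e_ e0 ec K K' v w c) => // n.
  have en := e0 n; have enL := eL n.
  have h1 : a <= a + e_ n <= b by apply/andP; split; lra.
  have h2 : a <= a <= b by rewrite lexx ltW.
  have := HK _ h1; have := HK' _ h1; have := HK' _ h2.
  have := Rintegral_heaviside_split (a + e_ n) iu su.
  have -> : \int[mu]_x (u x * heaviside (x - a)) = \int[mu]_x u x.
    apply: eq_Rintegral => x _; have [/andP[ax xb]|xab] := boolP (a < x < b).
      by rewrite heavisideE subr_gt0 ax mulr1.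
    by rewrite su// mul0r.
  have -> : \int[mu]_x (w x * (frac_power alpha (x - a) - frac_power alpha (x - a - e_ n))) =
     \int[mu]_x (w x * frac_power alpha (x - a)) -
     \int[mu]_x (w x * frac_power alpha (x - (a + e_ n))).
    rewrite -RintegralB//; last 2 first.
    - exact: ifp.
    - by apply: ifp => //; lra.
    by apply: eq_Rintegral => x _; rewrite mulrBr opprD addrA.
  have -> : \int[mu]_x (v x * frac_power alpha (e_ n - (x - a))) =
     \int[mu]_x (v x * frac_power alpha (a + e_ n - x)).
    by apply: eq_Rintegral => x _; congr (_ * frac_power _ _); ring.
  rewrite (_ : a + e_ n - a = e_ n); last ring.
  rewrite (_ : b - (a + e_ n) = b - a - e_ n); last ring.
  exact: alg.
(* Once K = 0, the right-hand side of the integrated formula is [c] times the primitive of this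
   fractional integral, by Fubini. Equality of the primitives then gives equality of the functions
   almost everywhere. *)
pose Q y := \int[mu]_x (v x * frac_kernel alpha (b - a) (y - x)).
have mK : measurable_fun setT (fun z : R * R => frac_kernel alpha (b - a) (z.2 - z.1)).
  by apply: measurableT_comp (measurable_frac_kernel _ _) _; exact: measurable_funB.
have Kb x : (\int[mu]_y `|frac_kernel alpha (b - a) (y - x)|%:E <= (frac_power alpha (b - a))%:E)%E.
  under eq_integral do rewrite ger0_norm ?frac_kernel_ge0//.
  rewrite (@integralDr _ (- x) (EFin \o frac_kernel alpha (b - a))).
    by rewrite integral_frac_kernel.
  by apply/measurable_EFinP; exact: measurable_frac_kernel.
have iQ : L1 Q by have [] := Fubini_kernel iv mK Kb.
have ig : L1 (fun y => B * u y + (- c) * Q y) by exact: integrable_lin.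
have Q0 y : y <= a -> Q y = 0.
  move=> ya; rewrite /Q -[RHS](mul0r (fine (mu setT))) -Rintegral_cst//.
  apply: eq_Rintegral => x _; have [/andP[ax xb]|xab] := boolP (a < x < b).
    rewrite frac_kernelE ifF ?mulr0//; apply/negbTE/negP => /andP[h _].
    have xy : x < y by rewrite -subr_gt0.
    by have := lt_trans ax (lt_le_trans xy ya); rewrite ltxx.
  by rewrite sv// mul0r.
have := ae_eq0_itv ig (a := a) (b := b); move=> H.
have /H : forall z, a < z < b ->
    \int[mu]_x ((B * u x + - c * Q x) * \1_`]a, z[ x) = 0.
  move=> z /andP[az zb].
  have bound2 x : (\int[mu]_y `|frac_kernel alpha (b - a) (y - x) * heaviside (z - y)|%:E <=
      (frac_power alpha (b - a))%:E)%E.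
    have mKx : measurable_fun setT (fun y => frac_kernel alpha (b - a) (y - x)).
      by apply: measurableT_comp (measurable_frac_kernel _ _) _; exact: measurable_funB.
    apply: le_trans (Kb x); apply: ge0_le_integral => //.
    - apply/measurable_EFinP; apply: measurableT_comp => //.
      by apply: measurable_funM => //; exact: mhv1.
    - by apply/measurable_EFinP; exact: measurableT_comp.
    - by move=> y _; rewrite lee_fin normrM ler_piMr// ger0_norm ?heaviside_ge0 ?heaviside_le1.
  have [iQh eQh] := Fubini_kernel_mul iv mK Kb (mhv1 z) bound2.
  transitivity (\int[mu]_y (B * (u y * heaviside (z - y)) + (- c) * (Q y * heaviside (z - y)))).
    apply: eq_Rintegral => y _; rewrite indicE mem_setE in_itv/= heavisideE subr_gt0.
    have [ay|ya] := ltP a y; first by rewrite /=; ring.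
    by rewrite Q0// su ?(le_gtF ya)//; ring.
  rewrite Rintegral_lin//; last exact: (@L1_mul _ _ 1).
  rewrite HK; last by rewrite !ltW.
  rewrite K0 mul0r add0r mulNr.
  have -> : \int[mu]_x (v x * frac_power alpha (z - x)) = \int[mu]_y (Q y * heaviside (z - y)).
    rewrite -eQh; apply: eq_Rintegral => x _.
    have [/andP[ax xb]|xab] := boolP (a < x < b); last by rewrite sv// !mul0r.
    congr (_ * _); rewrite -[LHS]/(fine (_)%:E).
    rewrite -(@integral_heaviside_frac_kernel _ _ (b - a))//; last by rewrite lerB// ltW.
    by congr fine; apply: eq_integral => y _; rewrite mulrC.
  by rewrite subrr.
apply: ae_imply => y hy yab; have /eqP := hy yab.
by rewrite mulNr subr_eq0 => /eqP.
Qed.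
End inversion.

(** * Primitives of test densities *)

Section primitives.
Context {R : realType}.
Local Notation mu := (@lebesgue_measure R).
Local Notation L1 f := (mu.-integrable setT (EFin \o f)).
Implicit Types (phi psi k : R -> R) (a b x z c : R).

(** A translation moves z from the kernel [k], which may be singular, to the smooth [phi];
    differentiation under the integral sign is then dominated by M |k|. *)
Lemma derive1_convolution phi psi k x (C M : R) : L1 k ->
  (forall z, is_derive z 1 phi (psi z)) -> measurable_fun setT psi ->
  (forall z, `|phi z| <= C) -> (forall z, `|psi z| <= M) ->
  (fun z => \int[mu]_y (phi y * k (y - z)))^`()%classic x =
  \int[mu]_y (psi y * k (y - x)).
Proof.
move=> ik dphi mpsi phiC psiM.
have mk := L1_measurable ik.
have mphi : measurable_fun setT phi.
  apply: continuous_measurable_fun => z.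
  by apply/differentiable_continuous/derivable1_diffP; exact: ex_derive.
have translate (f : R -> R) z : measurable_fun setT f ->
    \int[mu]_y (f y * k (y - z)) = \int[mu]_t (f (z + t) * k t).
  move=> mf; rewrite -(@RintegralDr _ z); last first.
    by apply: measurable_funM => //; apply: measurableT_comp mk _; exact: measurable_funB.
  by apply: eq_Rintegral => t _; rewrite addrK addrC.
rewrite (_ : (fun z => _) = fun z => \int[mu]_t (phi (z + t) * k t)); last first.
  by apply/funext => z; exact: translate.
rewrite translate//.
have dF z t : is_derive z 1 (fun z => phi (z + t) * k t) (psi (z + t) * k t).
  have h1 : is_derive z 1 (fun z => phi (z + t)) (psi (z + t) * 1).
    exact: (@is_derive1_comp R phi (shift t) z _ 1 (dphi (z + t)) (is_derive_shift z 1 t)).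
  have H : is_derive z 1 ((fun z => phi (z + t)) * (cst (k t) : R -> R)) (psi (z + t) * k t).
    by apply: is_derive_eq; rewrite /GRing.scale/= mulr0 add0r mulr1 mulrC.
  exact: H.
have pd z t : partial1of2 (fun z t => phi (z + t) * k t) z t = psi (z + t) * k t.
  by rewrite partial1of2E; apply: derive_val; exact: dF.
have C0 : 0 <= C by exact: le_trans (phiC 0).
have M0 : 0 <= M by exact: le_trans (psiM 0).
rewrite (@differentiation_under_integral R _ _ mu (fun z t => phi (z + t) * k t) setT
  measurableT x (x - 1) (x + 1) _ _ _ (fun t => M * `|k t|)).
- by apply: eq_Rintegral => t _; rewrite pd.
- by rewrite /= in_itv/= gtrBl ltrDl ltr01.
- move=> z _; apply: (@le_integrable_norm _ _ (fun t => C * `|k t|)).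
  + apply: measurable_funM => //; apply: measurableT_comp mphi _; exact: measurable_funD.
  + by move=> t; rewrite normrM ler_wpM2r.
  + exact: (integrableZl measurableT C (integrable_norm ik)).
- by move=> z t _ _; exact: ex_derive.
- by move=> t; rewrite mulr_ge0.
- exact: (integrableZl measurableT M (integrable_norm ik)).
- by move=> z t _ _; rewrite pd normrM ler_wpM2r.
Qed.

Definition primitive psi x : R := \int[mu]_y (heaviside (x - y) * psi y).

Section density.
Variables (a b : R) (psi : R -> R).
Hypothesis dpsi : test_density a b psi.

Let ipsi : L1 psi. Proof. exact: test_density_integrable dpsi. Qed.
Let mpsi : measurable_fun setT psi. Proof. exact: L1_measurable ipsi. Qed.

Let mh1 z : measurable_fun setT (fun y : R => heaviside (z - y)).
Proof. by apply: measurableT_comp measurable_heaviside _; exact: measurable_funB. Qed.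

Let mh2 z : measurable_fun setT (fun y : R => heaviside (y - z)).
Proof. by apply: measurableT_comp measurable_heaviside _; exact: measurable_funB. Qed.

Let ih (h : R -> R) : measurable_fun setT h -> (forall y, 0 <= h y <= 1) ->
  L1 (fun y => h y * psi y).
Proof.
move=> mh h01; apply: (@le_integrable_norm _ _ (fun y => `|psi y|)).
- exact: measurable_funM.
- by move=> y; case/andP: (h01 y) => h0 h1; rewrite normrM ler_piMl// ger0_norm.
- exact: integrable_norm.
Qed.

Let hv01 (t : R) : 0 <= heaviside t <= 1.
Proof. by rewrite heaviside_ge0 heaviside_le1. Qed.

(** As [psi] has mean zero, its integrals over the two sides of x cancel. This lets both
    orientations of the Heaviside kernel represent the same test function. *)
Lemma primitiveN x : primitive psi x = - \int[mu]_y (heaviside (y - x) * psi y).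
Proof.
apply/eqP; rewrite -addr_eq0; apply/eqP; case: (dpsi) => _ _ psi0.
have i1 := ih (mh1 x) (fun y => hv01 _); have i2 := ih (mh2 x) (fun y => hv01 _).
rewrite /primitive -RintegralD// -psi0; apply: ae_eq_Rintegral => //.
  by apply: measurable_funD; exact: L1_measurable.
have : {ae mu, forall y, y != x}.
  exists [set x]; split => //; first exact: lebesgue_measure_set1.
  by move=> y /=; rewrite /= => /negP/negPn/eqP.
apply: ae_imply => y xy; rewrite !heavisideE !subr_gt0.
by case: ltgtP xy => // _ _; rewrite ?mul1r ?mul0r ?addr0 ?add0r.
Qed.

Lemma primitive_le x : `|primitive psi x| <= \int[mu]_y `|psi y|.
Proof.
apply: (le_trans (le_normr_Rintegral measurableT (ih (mh1 x) (fun y => hv01 _)))).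
apply: le_Rintegral => //.
- exact: (integrable_norm (ih (mh1 x) (fun y => hv01 _))).
- exact: integrable_norm.
- by move=> y _; case/andP: (hv01 (x - y)) => h0 h1; rewrite normrM ler_piMl// ger0_norm.
Qed.

Lemma is_derive_primitive x : is_derive x 1 (primitive psi) (psi x).
Proof.
have spsi : smooth psi by case: dpsi.
have -> : primitive psi = fun z => \int[mu]_(t in [set` `]-oo, z]]) psi t.
  apply/funext => z; rewrite -Rintegral_itv_bndo_bndc; last first.
    by apply: integrableS ipsi => //; exact: measurable_itv.
  rewrite Rintegral_mkcond; apply: eq_Rintegral => y _.
  rewrite patch_indic /= mulrC heavisideE indicE mem_setE in_itv/= subr_gt0 //.
have [] := @continuous_FTC1 R psi -oo%O x (x + 1).
- by rewrite ltrDl.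
- by apply: integrableS ipsi => //; exact: measurable_itv.
- exact: ltNyr.
- exact: smooth_continuous.
by move=> d1 d2; apply: DeriveDef; [exact: d1|rewrite -derive1E; exact: d2].
Qed.

Lemma smooth_prim : smooth (primitive psi).
Proof.
have spsi : smooth psi by case: dpsi.
exact: smooth_primitive spsi is_derive_primitive.
Qed.

(** To the left of the support of [psi] the integrand vanishes; to the right the same holds after
    [primitiveN], which is where the zero mean enters. *)
Lemma primitive_support : exists s t, [/\ a < s, t < b &
  forall x, primitive psi x != 0 -> s <= x <= t].
Proof.
case: (dpsi) => _ [s [t [as_ tb pst]]] psi0; exists s, t; split => // x.
have int0 (f : R -> R) : (forall y, f y = 0) -> \int[mu]_y f y = 0.
  move=> f0; transitivity (\int[mu]_y (cst 0 y : R)); last by rewrite Rintegral_cst// mul0r.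
  by apply: eq_Rintegral => y _.
apply: contraNT; rewrite negb_and -!ltNge => /orP[xs|tx].
  rewrite /primitive int0// => y; have [->|/pst/andP[sy yt]] := eqVneq (psi y) 0.
    by rewrite mulr0.
  by rewrite heavisideE subr_gt0 ltNge (le_trans (ltW xs) sy) mul0r.
rewrite primitiveN int0 ?oppr0// => y; have [->|/pst/andP[sy yt]] := eqVneq (psi y) 0.
  by rewrite mulr0.
by rewrite heavisideE subr_gt0 ltNge (le_trans yt (ltW tx)) mul0r.
Qed.

Lemma test_function_primitive : test_function [set` `]a, b[] (primitive psi).
Proof.
have [s [t [as_ tb pst]]] := primitive_support.
have sub : closure [set x | [set` `]a, b[] x /\ primitive psi x != 0] `<=` `[s, t]%classic.
  rewrite [X in _ `<=` X](closure_id _).1; last exact: interval_closed.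
  by apply: closureS => x [_ /pst]; rewrite /= in_itv.
split.
- by move=> n x _; apply: smooth_derivable; exact: smooth_prim.
- apply: subclosed_compact sub; first exact: closed_closure.
  exact: segment_compact.
- move=> x /sub; rewrite /= !in_itv/= => /andP[sx xt].
  by rewrite (lt_le_trans as_ sx) (le_lt_trans xt tb).
Qed.

Lemma primitive_patch : primitive psi \_ [set` `]a, b[] = primitive psi.
Proof.
apply/funext => x; rewrite patchE; case: ifPn => // /negP xab.
have [s [t [as_ tb pst]]] := primitive_support.
apply/esym/eqP/negPn/negP => /pst/andP[sx xt]; apply: xab.
by rewrite mem_setE in_itv/= (lt_le_trans as_ sx) (le_lt_trans xt tb).
Qed.

End density.
End primitives.

(** * Weak fractional derivatives *)

Section weak_derivatives.
Context {R : realType}.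
Local Notation mu := (@lebesgue_measure R).
Local Notation L1 f := (mu.-integrable setT (EFin \o f)).
Variables (a b alpha : R).
Hypotheses (ab : a < b) (alpha01 : 0 < alpha < 1).
Implicit Types (u v phi psi k : R -> R) (x z c : R).

Let Omega : set R := [set` `]a, b[].
Let alpha1 : 0 < 1 - alpha. Proof. by rewrite subr_gt0; case/andP: alpha01. Qed.
Let ka := frac_kernel (1 - alpha) (b - a).

Lemma supported_patch u : supported a b (u \_ Omega).
Proof. by move=> x xab; rewrite patchE ifF// mem_setE in_itv/=; exact/negbTE. Qed.

Let ka_inside t : 0 < t < b - a -> ka t = (t `^ alpha)^-1.
Proof.
move=> h; rewrite /ka frac_kernelE h -powRN; congr (_ `^ _); ring.
Qed.

Let ik : L1 ka. Proof. exact: frac_kernel_integrable. Qed.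

Let ikN : L1 (fun t => ka (- t)).
Proof.
have := integrable_reflect 0 ik; apply: eq_integrable => // t _ /=.
by rewrite sub0r.
Qed.

Section density.
Variable psi : R -> R.
Hypothesis dpsi : test_density a b psi.
Let phi := primitive psi.

Let phi_out y : phi y != 0 -> a < y < b.
Proof.
have [s [t [as_ tb pst]]] := primitive_support dpsi.
by move=> /pst/andP[sy yt]; rewrite (lt_le_trans as_ sy) (le_lt_trans yt tb).
Qed.

Let derive1_conv k x : L1 k ->
  (fun z => \int[mu]_y (phi y * k (y - z)))^`()%classic x = \int[mu]_y (psi y * k (y - x)).
Proof.
move=> ik'; have [M psiM] := test_density_bounded dpsi.
apply: (@derive1_convolution _ phi psi k x (\int[mu]_y `|psi y|) M) => //.
- exact: is_derive_primitive dpsi.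
- exact: L1_measurable (test_density_integrable dpsi).
- exact: primitive_le dpsi.
Qed.

Let near_derive1 (f g : R -> R) x : a < x < b -> (forall z, a < z < b -> f z = g z) ->
  f^`()%classic x = g^`()%classic x.
Proof.
move=> xab fg; rewrite !derive1E; apply: near_eq_derive.
have : x \in `]a, b[ by rewrite in_itv.
move=> /near_in_itvoo; apply: filterS => z; rewrite in_itv/= => zab; exact: fg.
Qed.

(** For z in (a, b), the kernel of the definition may be replaced by the truncated, integrable [ka],
    since the test function vanishes outside (a, b) and differences inside are smaller than b - a.
    This agreement near x is enough for the derivative, which then falls on the test function. *)
Lemma right_frac_deriv_primitive x : a < x < b ->
  right_frac_deriv alpha (primitive psi \_ Omega) x =
  - (Gamma (1 - alpha))^-1 * \int[mu]_y (ka (y - x) * psi y).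
Proof.
move=> xab; rewrite primitive_patch// /right_frac_deriv; congr (_ * _).
transitivity (\int[mu]_y (psi y * ka (y - x))); last first.
  by apply: eq_Rintegral => y _; rewrite mulrC.
rewrite -derive1_conv//; apply: near_derive1 => // z /andP[az zb].
rewrite Rintegral_mkcond; apply: eq_Rintegral => y _.
rewrite patchE mem_setE in_itv/= andbT.
rewrite -/phi; have [->|/phi_out/andP[ay yb]] := eqVneq (phi y) 0.
  by rewrite !mul0r; case: ifP.
have [zy|yz] := ltP z y.
  by rewrite ka_inside// subr_gt0 zy/=; lra.
rewrite /ka frac_kernelE ifF ?mulr0//; apply/negbTE/negP => /andP[h _].
by move: h; rewrite subr_gt0 ltNge yz.
Qed.

Lemma left_frac_deriv_primitive x : a < x < b ->
  left_frac_deriv alpha (primitive psi \_ Omega) x =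
  (Gamma (1 - alpha))^-1 * \int[mu]_y (ka (x - y) * psi y).
Proof.
move=> xab; rewrite primitive_patch// /left_frac_deriv; congr (_ * _).
transitivity (\int[mu]_y (psi y * ka (- (y - x)))); last first.
  by apply: eq_Rintegral => y _; rewrite opprB mulrC.
rewrite -(derive1_conv x ikN)//; apply: near_derive1 => // z /andP[az zb].
rewrite Rintegral_mkcond; apply: eq_Rintegral => y _.
rewrite patchE mem_setE in_itv/= opprB.
rewrite -/phi; have [->|/phi_out/andP[ay yb]] := eqVneq (phi y) 0.
  by rewrite !mul0r; case: ifP.
have [zy|yz] := ltP y z.
  by rewrite ka_inside// subr_gt0 zy/=; lra.
rewrite /ka frac_kernelE ifF ?mulr0//; apply/negbTE/negP => /andP[h _].
by move: h; rewrite subr_gt0 ltNge yz.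
Qed.

Let mk_sub (s : R) : measurable_fun setT (fun p : R * R => ka (s * (p.2 - p.1))).
Proof.
apply: measurableT_comp (measurable_frac_kernel _ _) _.
by apply: measurable_funM => //; exact: measurable_funB.
Qed.

Let kbound1 x : (\int[mu]_y `|ka (y - x)|%:E <= (frac_power (1 - alpha) (b - a))%:E)%E.
Proof.
under eq_integral do rewrite ger0_norm ?frac_kernel_ge0//.
rewrite (@integralDr _ (- x) (EFin \o ka)).
  by rewrite integral_frac_kernel.
by apply/measurable_EFinP; exact: measurable_frac_kernel.
Qed.

Let kbound2 x : (\int[mu]_y `|ka (x - y)|%:E <= (frac_power (1 - alpha) (b - a))%:E)%E.
Proof.
under eq_integral do rewrite ger0_norm ?frac_kernel_ge0//.
rewrite (@integral_reflect _ x (EFin \o ka)).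
  by rewrite integral_frac_kernel.
by apply/measurable_EFinP; exact: measurable_frac_kernel.
Qed.

Let mka1 x : measurable_fun setT (fun y : R => ka (y - x)).
Proof. by apply: measurableT_comp (measurable_frac_kernel _ _) _; exact: measurable_funB. Qed.

Let mka2 x : measurable_fun setT (fun y : R => ka (x - y)).
Proof. by apply: measurableT_comp (measurable_frac_kernel _ _) _; exact: measurable_funB. Qed.

Lemma integrable_left_form u : L1 u -> L1 (fun x => u x * \int[mu]_y (ka (y - x) * psi y)).
Proof.
move=> iu; have [M psiM] := test_density_bounded dpsi.
have mpsi := L1_measurable (test_density_integrable dpsi).
have [] // := @Fubini_kernel _ u (fun x y => ka (y - x) * psi y) _ iu _
  (kernel_mul_bound mka1 kbound1 mpsi psiM).
apply: measurable_funM; last exact: measurableT_comp mpsi measurable_snd.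
by have := mk_sub 1; under eq_fun do rewrite mul1r.
Qed.

Lemma integrable_right_form u : L1 u -> L1 (fun x => u x * \int[mu]_y (ka (x - y) * psi y)).
Proof.
move=> iu; have [M psiM] := test_density_bounded dpsi.
have mpsi := L1_measurable (test_density_integrable dpsi).
have [] // := @Fubini_kernel _ u (fun x y => ka (x - y) * psi y) _ iu _
  (kernel_mul_bound mka2 kbound2 mpsi psiM).
apply: measurable_funM; last exact: measurableT_comp mpsi measurable_snd.
by have := mk_sub (-1); under eq_fun do rewrite mulN1r opprB.
Qed.

End density.

Let Rintegral_patch u (f : R -> R) :
  \int[mu]_(x in Omega) (u x * f x) = \int[mu]_x ((u \_ Omega) x * f x).
Proof.
rewrite Rintegral_mkcond; apply: eq_Rintegral => x _; rewrite !patchE.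
by case: ifPn => // _; rewrite mul0r.
Qed.

Let c0 : Gamma (1 - alpha) != 0 :> R.
Proof. by rewrite gt_eqF// Gamma_gt0// alpha1 gtrBl; case/andP: alpha01. Qed.

Let integrable_mul_primitive v psi : test_density a b psi -> L1 v ->
  L1 (fun x => v x * primitive psi x).
Proof.
move=> dpsi iv.
apply: (@le_integrable_norm _ _ (fun x => (\int[mu]_y `|psi y|) * `|v x|)).
- apply: measurable_funM; first exact: L1_measurable.
  by apply: smooth_measurable; exact: smooth_prim dpsi.
- by move=> x; rewrite normrM mulrC ler_wpM2r// (primitive_le dpsi).
- exact: (integrableZl measurableT (\int[mu]_y `|psi y|) (integrable_norm iv)).
Qed.

Lemma left_weak_identity u v : left_weak_deriv Omega alpha u v ->
  L1 (u \_ Omega) -> L1 (v \_ Omega) ->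
  weak_identity a b alpha (Gamma (1 - alpha)) (u \_ Omega) (v \_ Omega).
Proof.
move=> [_ _ H] iu iv psi dpsi; have := H _ (test_function_primitive dpsi).
rewrite !Rintegral_patch => e.
have eN : \int[mu]_x ((v \_ Omega) x * \int[mu]_y (heaviside (y - x) * psi y)) =
    - \int[mu]_x ((v \_ Omega) x * primitive psi x).
  rewrite -mulN1r -RintegralZl_setT; last exact: integrable_mul_primitive.
  by apply: eq_Rintegral => x _; rewrite (primitiveN dpsi); ring.
rewrite eN e; have alg (g X Y : R) : g != 0 -> X = - g^-1 * Y -> g * - X = Y.
  by move=> g0 ->; field.
apply: alg => //.
rewrite -RintegralZl_setT; last exact: (integrable_left_form dpsi iu).
apply: eq_Rintegral => x _; have [xab|xab] := boolP (a < x < b); last first.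
  by rewrite (supported_patch _ xab) !mul0r mulr0.
by rewrite (right_frac_deriv_primitive dpsi xab) mulrCA.
Qed.

Lemma right_weak_identity u v : right_weak_deriv Omega alpha u v ->
  L1 (u \_ Omega) ->
  weak_identity_right a b alpha (Gamma (1 - alpha)) (u \_ Omega) (v \_ Omega).
Proof.
move=> [_ _ H] iu psi dpsi; have := H _ (test_function_primitive dpsi).
rewrite !Rintegral_patch => e.
transitivity (Gamma (1 - alpha) * \int[mu]_x ((v \_ Omega) x * primitive psi x)) => //.
rewrite e; have alg (g X Y : R) : g != 0 -> X = g^-1 * Y -> g * X = Y.
  by move=> g0 ->; field.
apply: alg => //.
rewrite -RintegralZl_setT; last exact: (integrable_right_form dpsi iu).
apply: eq_Rintegral => x _; have [xab|xab] := boolP (a < x < b); last first.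
  by rewrite (supported_patch _ xab) !mul0r mulr0.
by rewrite (left_frac_deriv_primitive dpsi xab) mulrCA.
Qed.

End weak_derivatives.

(** * Young's inequality *)

Section young.
Context {R : realType}.
Local Notation mu := (@lebesgue_measure R).
Local Notation L1 f := (mu.-integrable setT (EFin \o f)).
Implicit Types (f k u v : R -> R) (x y : R).

(* Jensen's inequality for the weight [k], obtained by integrating Young's
   inequality [p f A^(p-1) <= f^p + (p-1) A^p] at the mean [A] of [f]. *)
Lemma weighted_power_mean (p : R) f k : 1 < p -> (forall x, 0 <= f x) ->
  (forall x, 0 <= k x) -> 0 < \int[mu]_x k x -> L1 k ->
  L1 (fun x => f x * k x) -> L1 (fun x => f x `^ p * k x) ->
  (\int[mu]_x (f x * k x)) `^ p <=
  (\int[mu]_x k x) `^ (p - 1) * \int[mu]_x (f x `^ p * k x).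
Proof.
move=> p1 f0 k0 M0 ik ifk ifpk.
have p0 : 0 < p by exact: lt_trans p1.
have q0 : 0 < p - 1 by rewrite subr_gt0.
set M := \int[mu]_x k x in M0 *; set S := \int[mu]_x (f x `^ p * k x).
set J := \int[mu]_x (f x * k x).
have J0 : 0 <= J by apply: Rintegral_ge0 => x _; rewrite mulr_ge0.
pose A := J / M; have A0 : 0 <= A by rewrite divr_ge0// ltW.
have young t : 0 <= t -> p * A `^ (p - 1) * t <= t `^ p + (p - 1) * A `^ p.
  move=> t0; pose q := p / (p - 1).
  have := @conjugate_powR R t (A `^ (p - 1)) p q t0 (powR_ge0 _ _) p0 (divr_gt0 p0 q0).
  rewrite -powRrM /q (_ : (p - 1) * (p / (p - 1)) = p); last first.
    by field; rewrite gt_eqF.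
  have -> : p^-1 + (p / (p - 1))^-1 = 1 by field; rewrite !gt_eqF.
  move=> /(_ erefl); rewrite -(ler_pM2l p0) => h.
  rewrite (_ : p * A `^ (p - 1) * t = p * (t * A `^ (p - 1))); last ring.
  apply: (le_trans h); rewrite le_eqVlt; apply/orP; left; apply/eqP.
  by field; rewrite !gt_eqF.
have : p * A `^ (p - 1) * J <= S + (p - 1) * A `^ p * M.
  rewrite -[S]mul1r -RintegralZl_setT// -Rintegral_lin//.
  apply: le_Rintegral => //.
  - exact: (integrableZl measurableT (p * A `^ (p - 1)) ifk).
  - exact: integrable_lin.
  - move=> x _; rewrite mul1r mulrA -mulrDl ler_wpM2r//; exact: young.
have -> : p * A `^ (p - 1) * J = p * A `^ p * M.
  rewrite -(mulr_powRB1 A0 p0) /A; field; rewrite gt_eqF//.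
move=> h; have {}h : A `^ p * M <= S by lra.
have -> : J `^ p = M `^ (p - 1) * (A `^ p * M).
  have -> : J = A * M by rewrite /A divfK// gt_eqF.
  by rewrite powRM// ?(ltW M0)// -(mulr_powRB1 (ltW M0) p0); ring.
by rewrite ler_wpM2l// powR_ge0.
Qed.

(** For almost every y, [weighted_power_mean] is applied with the weight [k (y - x)] of mass M,
    which costs M^(p-1). Integrating in y by Fubini contributes one more factor M. *)
Lemma young_convolution (p : R) v k : 1 < p -> L1 k -> (forall x, 0 <= k x) ->
  0 < \int[mu]_x k x -> L1 v -> L1 (fun x => `|v x| `^ p) ->
  measurable_fun setT (fun y => \int[mu]_x (v x * k (y - x))) /\
  (\int[mu]_y (`|\int[mu]_x (v x * k (y - x))| `^ p)%:E <=
   ((\int[mu]_x k x) `^ p * \int[mu]_x (`|v x| `^ p))%:E)%E.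
Proof.
move=> p1 ik k0 M0 iv ivp.
have mk := L1_measurable ik.
have mK : measurable_fun setT (fun z : R * R => k (z.2 - z.1)).
  by apply: measurableT_comp mk _; exact: measurable_funB.
set M := \int[mu]_x k x in M0 *.
have intk x : (\int[mu]_y (k (y - x))%:E = M%:E)%E.
  by rewrite (@integralDr _ (- x) (EFin \o k)) ?EFin_Rintegral//; exact/measurable_EFinP.
have KM x : (\int[mu]_y `|k (y - x)|%:E <= M%:E)%E.
  by under eq_integral do rewrite ger0_norm//; rewrite intk.
have [_ iT ae1 _] := @Fubini_kernel R v (fun x y => k (y - x)) M iv mK KM.
have [_ iS ae2 eS] := @Fubini_kernel R _ (fun x y => k (y - x)) M ivp mK KM.
have mT := L1_measurable iT; split => //.
have p0 : 0 < p by exact: lt_trans p1.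
have eM : \int[mu]_y (M `^ (p - 1) * \int[mu]_x (`|v x| `^ p * k (y - x))) =
    M `^ p * \int[mu]_x (`|v x| `^ p).
  have e x : `|v x| `^ p * \int[mu]_y k (y - x) = M * `|v x| `^ p.
    by rewrite mulrC /Rintegral intk.
  have eSM : \int[mu]_x (`|v x| `^ p * \int[mu]_y k (y - x)) = M * \int[mu]_x (`|v x| `^ p).
    by rewrite -RintegralZl_setT//; apply: eq_Rintegral => x _; exact: e.
  by rewrite RintegralZl_setT// -eS eSM -(mulr_powRB1 (ltW M0) p0); ring.
have iR : L1 (fun y => M `^ (p - 1) * \int[mu]_x (`|v x| `^ p * k (y - x))).
  exact: (integrableZl measurableT (M `^ (p - 1)) iS).
rewrite -eM EFin_Rintegral//.
apply: (@ae_ge0_le_integral _ _ _ mu setT) => //.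
- apply/measurable_EFinP; apply: measurableT_comp (measurable_powR _) _.
  exact: measurableT_comp.
- move=> y _; rewrite lee_fin mulr_ge0 ?powR_ge0//; apply: Rintegral_ge0 => x _.
  by rewrite mulr_ge0 ?powR_ge0.
- by apply/measurable_EFinP; exact: L1_measurable.
apply: ae_imply2 ae1 ae2 => y i1 i2 _; rewrite lee_fin.
have ikr : L1 (fun x => k (y - x)) by exact: integrable_reflect.
have ek : \int[mu]_x k (y - x) = M by rewrite Rintegral_reflect.
have ia : L1 (fun x => `|v x| * k (y - x)).
  have := integrable_norm i1; apply: eq_integrable => // x _ /=.
  by rewrite normrM (ger0_norm (k0 _)).
have := @weighted_power_mean p (fun x => `|v x|) (fun x => k (y - x)) p1
  (fun x => normr_ge0 _) (fun x => k0 _) _ ikr ia i2.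
rewrite ek => /(_ M0); apply: le_trans.
rewrite ge0_ler_powR ?nnegrE ?(ltW p0)//.
  by apply: Rintegral_ge0 => x _; rewrite mulr_ge0.
apply: (le_trans (le_normr_Rintegral measurableT i1)).
apply: le_Rintegral => //; first exact: integrable_norm.
by move=> x _; rewrite normrM (ger0_norm (k0 _)).
Qed.

End young.

(** * Lebesgue spaces on a bounded interval *)

Section main_estimates.
Context {R : realType}.
Local Notation mu := (@lebesgue_measure R).
Local Notation L1 f := (mu.-integrable setT (EFin \o f)).
Variables (a b : R).
Hypothesis ab : a < b.
Let Omega : set R := [set` `]a, b[].
Implicit Types (p : R) (u v : R -> R).

Lemma Lp_space_integrable_powR p v : 1 < p -> Lp_space Omega p v ->
  L1 (fun x => `|(v \_ Omega) x| `^ p).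
Proof. by move=> p1 /Lfun_integrable; apply; exact: ltW. Qed.

(** On the interval |v| <= 1 + |v|^p, and the constant 1 is integrable there because the interval is
    bounded. *)
Lemma Lp_space_integrable p v : 1 < p -> Lp_space Omega p v -> L1 (v \_ Omega).
Proof.
move=> p1 vp; have ip := Lp_space_integrable_powR p1 vp.
have mv : measurable_fun setT (v \_ Omega).
  by move: vp; rewrite /Lp_space/= inE => /andP[]; rewrite inE.
apply: (@le_integrable_norm _ _ (fun x => 1 * \1_Omega x + 1 * `|(v \_ Omega) x| `^ p)) => //.
  move=> x; rewrite !mul1r indicE patchE; case: ifPn => // _; last first.
    by rewrite normr0 addr_ge0// powR_ge0.
  have [v1|v1] := leP `|v x| 1; first by rewrite (le_trans v1)// lerDl powR_ge0.
  by rewrite ler_wpDl// le1r_powR// ltW.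
by apply: integrable_lin => //; exact: integrable_indic_itv.
Qed.

Lemma Lp_space1_integrable v : Lp_space Omega 1 v -> L1 (v \_ Omega).
Proof. by move=> /Lfun1_integrable. Qed.

Lemma Lp_norm_finite p v : measurable_fun Omega v -> (Lp_norm Omega p v < +oo)%E ->
  Lp_space Omega p v.
Proof.
move=> mv vfin; rewrite /Lp_space/= inE; apply/andP; split; rewrite inE/=//.
by apply/(measurable_restrictT v) => //; exact: measurable_itv.
Qed.

Lemma Lp_norm_le p u v (C : R) : 1 < p -> 0 <= C ->
  L1 (fun x => `|(v \_ Omega) x| `^ p) ->
  (\int[mu]_x (`|(u \_ Omega) x| `^ p)%:E <=
   (C `^ p * \int[mu]_x (`|(v \_ Omega) x| `^ p))%:E)%E ->
  (Lp_norm Omega p u <= C%:E * Lp_norm Omega p v)%E.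
Proof.
move=> p1 C0 iv uv; rewrite /Lp_norm unlock /=.
have p0 : 0 < p by exact: lt_trans p1.
have e (w : R -> R) : (\int[mu]_x (`|(w \_ Omega) x|%:E `^ p) =
    \int[mu]_x (`|(w \_ Omega) x| `^ p)%:E)%E.
  by apply: eq_integral => x _; rewrite poweR_EFin.
rewrite !e -(EFin_Rintegral iv) poweR_EFin.
set V := \int[mu]_x _ in uv *.
have V0 : 0 <= V by apply: Rintegral_ge0 => x _; rewrite powR_ge0.
have U0 : (0 <= \int[mu]_x (`|(u \_ Omega) x| `^ p)%:E)%E.
  by apply: integral_ge0 => x _; rewrite lee_fin powR_ge0.
apply: (@le_trans _ _ ((C `^ p * V)%:E `^ p^-1)%E).
  by apply: gt0_ler_poweR; rewrite ?invr_ge0 ?(ltW p0)// in_itv/= leey andbT// lee_fin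
    mulr_ge0// powR_ge0.
rewrite poweR_EFin lee_fin powRM ?powR_ge0// -powRrM divff ?gt_eqF//.
by rewrite powRr1.
Qed.

End main_estimates.

(** * The fractional Poincare inequality *)

Section poincare.
Context {R : realType}.
Local Notation mu := (@lebesgue_measure R).
Local Notation L1 f := (mu.-integrable setT (EFin \o f)).
Variables (a b alpha : R).
Hypotheses (ab : a < b) (alpha01 : 0 < alpha < 1).
Implicit Types (p B c : R) (u v w : R -> R).
Let Omega : set R := [set` `]a, b[].
Let M := frac_power alpha (b - a).
Let alpha0 : 0 < alpha. Proof. by case/andP: alpha01. Qed.
Let alpha1 : 0 < 1 - alpha. Proof. by rewrite subr_gt0; case/andP: alpha01. Qed.

Lemma frac_power_gt0 : 0 < M.
Proof.
rewrite /M frac_power_pos ?subr_gt0//; apply: divr_gt0 => //.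
by rewrite powR_gt0// subr_gt0.
Qed.

Lemma fractional_integral_bound p B c u v : 1 < p -> 0 < B -> 0 <= c ->
  L1 u -> supported a b u -> L1 v -> L1 (fun x => `|v x| `^ p) ->
  {ae mu, forall y, a < y < b ->
    B * u y = c * \int[mu]_x (v x * frac_kernel alpha (b - a) (y - x))} ->
  (\int[mu]_x (`|u x| `^ p)%:E <=
   ((c / B * M) `^ p * \int[mu]_x (`|v x| `^ p))%:E)%E.
Proof.
move=> p1 B0 c0 iu su iv ivp uv.
have p0 : 0 < p by exact: lt_trans p1.
have cB : 0 <= c / B by rewrite divr_ge0// ltW.
have M0 := frac_power_gt0.
have ek : \int[mu]_x frac_kernel alpha (b - a) x = M.
  by rewrite /Rintegral integral_frac_kernel.
have := @young_convolution R p v _ p1 (frac_kernel_integrable (b - a) alpha0)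
  (frac_kernel_ge0 _ _) _ iv ivp.
rewrite ek => /(_ M0)[mT young].
set T := fun y => _ in mT; rewrite powRM ?(ltW M0)// -mulrA EFinM.
apply: (le_trans _ (lee_wpmul2l _ young)); last by rewrite lee_fin powR_ge0.
have mTp : measurable_fun setT (fun y => `|T y| `^ p).
  by apply: measurableT_comp (measurable_powR _) _; exact: measurableT_comp.
rewrite -ge0_integralZl_EFin ?powR_ge0//; last exact/measurable_EFinP.
apply: (@ae_ge0_le_integral _ _ _ mu setT) => //.
- apply/measurable_EFinP; apply: measurableT_comp (measurable_powR _) _.
  by apply: measurableT_comp => //; exact: L1_measurable.
- by move=> y _; rewrite mule_ge0// lee_fin powR_ge0.
- by apply/measurable_EFinP; exact: measurable_funM.
apply: ae_imply uv => y uv _.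
rewrite -EFinM lee_fin; have [yab|yab] := boolP (a < y < b); last first.
  by rewrite su// normr0 powR0 ?gt_eqF// mulr_ge0 ?powR_ge0.
have -> : u y = c / B * T y.
  by rewrite mulrAC -(uv yab) mulrAC divff ?mul1r// gt_eqF.
by rewrite normrM (ger0_norm cB) (powRM _ cB (normr_ge0 _)).
Qed.

Variables (p : R) (u : R -> R).
Hypothesis p1 : 1 < p.

(** A weak derivative is only known to be locally integrable. If its norm is infinite the estimate
    is trivial, as C > 0; otherwise local integrability provides the measurability needed for
    membership in L^p. *)
Lemma weak_deriv_finite v C : 0 < C -> locally_integrable Omega v ->
  (Lp_space Omega p v -> (Lp_norm Omega p u <= C%:E * Lp_norm Omega p v)%E) ->
  (Lp_norm Omega p u <= C%:E * Lp_norm Omega p v)%E.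
Proof.
move=> C0 [mv _ _] H; have [vy|] := eqVneq (Lp_norm Omega p v) +oo%E.
  by rewrite vy gt0_muley ?lte_fin// leey.
by rewrite -ltey => vfin; apply: H; exact: Lp_norm_finite.
Qed.

Variables (B : R).
Hypothesis B0 : 0 < B.
Hypothesis beta : forall L x z, z - x <= L ->
  (\int[mu]_y (frac_kernel (1 - alpha) L (y - x) * frac_kernel alpha L (z - y))%:E =
   (B * heaviside (z - x))%:E)%E.
Let c := Gamma (1 - alpha).
Let c0 : 0 < c.
Proof. by apply: Gamma_gt0; rewrite alpha1 gtrBl alpha0. Qed.
(** The factor [c / B] comes from the inversion formula, and [M] is the mass of the kernel
    t^(alpha-1) on (0, b - a) in Young's inequality. *)
Let C := c / B * M.
Let C0 : 0 < C. Proof. by rewrite mulr_gt0 ?frac_power_gt0// divr_gt0. Qed.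

(** The opposite derivative [w] does not appear in the bound: it serves to kill the boundary term in
    [abel_inversion]. *)
Lemma left_poincare v w : left_weak_deriv Omega alpha u v ->
  right_weak_deriv Omega alpha u w -> Lp_space Omega p w ->
  (Lp_norm Omega p u <= C%:E * Lp_norm Omega p v)%E.
Proof.
move=> uv uw wp; have [u1 vloc _] := uv; apply: weak_deriv_finite => // vp.
have iu := Lp_space1_integrable u1; have iv := Lp_space_integrable p1 vp.
have iw := Lp_space_integrable p1 wp.
have ivp := Lp_space_integrable_powR p1 vp.
apply: Lp_norm_le => //; first exact: ltW.
apply: fractional_integral_bound => //; first exact: ltW.
  exact: supported_patch.
exact: (abel_inversion ab alpha01 B0 beta iu iv iw (@supported_patch _ a b u)
  (@supported_patch _ a b v) (@supported_patch _ a b w)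
  (left_weak_identity alpha01 uv iu iv) (right_weak_identity alpha01 uw iu)).
Qed.

(** After reflection the two derivatives exchange sides, so the same inversion formula expresses the
    reflected [u] through the reflected [v]. The integrals of p-th powers are invariant under
    reflection. *)
Lemma right_poincare v w : right_weak_deriv Omega alpha u v ->
  left_weak_deriv Omega alpha u w -> Lp_space Omega p w ->
  (Lp_norm Omega p u <= C%:E * Lp_norm Omega p v)%E.
Proof.
move=> uv uw wp; have [u1 vloc _] := uv; apply: weak_deriv_finite => // vp.
have iu := Lp_space1_integrable u1; have iv := Lp_space_integrable p1 vp.
have iw := Lp_space_integrable p1 wp.
have ivp := Lp_space_integrable_powR p1 vp.
apply: Lp_norm_le => //; first exact: ltW.
have Wv := weak_identity_right_reflect alpha1 iu iv (right_weak_identity alpha01 uv iu).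
have Ww := weak_identity_reflect alpha1 iu iw (left_weak_identity alpha01 uw iu iw).
have mp f : L1 f -> measurable_fun setT (fun x => `|f x| `^ p).
  move=> /L1_measurable mf; apply: measurableT_comp (measurable_powR _) _.
  exact: measurableT_comp.
have iur := integrable_reflect (a + b) iu; have ivr := integrable_reflect (a + b) iv.
have iwr := integrable_reflect (a + b) iw.
have := @fractional_integral_bound p B c _ _ p1 B0 (ltW c0) iur
  (supported_reflect (@supported_patch _ a b u)) ivr (integrable_reflect (a + b) ivp)
  (abel_inversion ab alpha01 B0 beta iur ivr iwr
    (supported_reflect (@supported_patch _ a b u)) (supported_reflect (@supported_patch _ a b v))
    (supported_reflect (@supported_patch _ a b w)) Wv Ww).
rewrite (@integral_reflect _ (a + b) (fun x => (`|(u \_ Omega) x| `^ p)%:E)); last first.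
  by apply/measurable_EFinP; exact: mp.
by rewrite (@Rintegral_reflect _ (a + b) (fun x => `|(v \_ Omega) x| `^ p))//; exact: mp.
Qed.

End poincare.

(* The constant depends on [alpha] and [Omega] only, hence is chosen before [p].
   A weak derivative [v] is any representative of its class. *)
Theorem theorem4p27 (R : realType) (a b alpha : R)
    (ab : a < b) (alpha01 : 0 < alpha < 1) :
  let Omega : set R := [set` `]a, b[] in
  exists C : R, 0 < C /\
    forall p : R, 1 < p ->
    forall u : R -> R, frac_Sobolev Omega alpha p u ->
      (forall v : R -> R, left_weak_deriv Omega alpha u v ->
        (Lp_norm Omega p u <= C%:E * Lp_norm Omega p v)%E) /\
      (forall v : R -> R, right_weak_deriv Omega alpha u v ->
        (Lp_norm Omega p u <= C%:E * Lp_norm Omega p v)%E).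
Proof.
move=> Omega; have [B B0 beta] := beta_integral_frac_kernel alpha01.
have /andP[alpha0 alpha1] := alpha01.
exists (Gamma (1 - alpha) / B * frac_power alpha (b - a)); split.
  rewrite mulr_gt0 ?frac_power_gt0// divr_gt0// Gamma_gt0//.
  by rewrite subr_gt0 alpha1 gtrBl.
move=> p p1 u [[_ [w uw wp]] [_ [w' uw' wp']]]; split=> v uv.
(* The derivative [v] being estimated is arbitrary; membership in the symmetric space contributes
   the opposite derivative, in L^p. *)
- exact: left_poincare uv uw' wp'.
- exact: right_poincare uv uw wp.
Qed.
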